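(* Let $P$ be a poset, $\mathbf{k}$ a field, $\varphi:P\times P\to P$ an order-preserving map, and let $A$ be a persistence module indexed by $P$. Let $(K,d)$ be a chain complex of persistence modules that has all terms projective and whose subcomplex of boundaries $B$ also has all terms projective. For all $n\ge 0$, there is a natural short exact sequence $$0\to \mathbf{Ext}^1_{\varphi}(H_{n-1}(K),A)\to H^n(\mathscr{H}om^{\varphi}(K, A))\to \mathscr{H}om^{\varphi}(H_n(K),A)\to 0.$$ Furthermore the short exact sequence splits, although not naturally.
   Context: A poset $P$ is viewed as a category $\mathbf{P}$ with a unique morphism $p\to q$ iff $p\le q$. A persistence module is a functor $M:\mathbf{P}\to\mathbf{Vect}_{\mathbf{k}}$; they form the abelian category $\mathbf{k}^{\mathbf{P}}$ (exactness is pointwise), which has enough projectives and injectives. $P\times P$ has the product order with projections $\pi_1,\pi_2$. For order-preserving $f:P\to Q$: $(f^{-1}G)_p=G_{f(p)}$ and $(f_*F)_q=\lim_{q\le f(p)}F_p$. For a poset $Q$, $\mathscr{H}om_{\mathbf{Q}}(M,N)_q=\mathrm{Hom}_{\mathbf{k}^{\mathbf{U}_q}}(M|_{\mathbf{U}_q},N|_{\mathbf{U}_q})$, $U_q=\{q'\in Q:q\le q'\}$, with restriction maps as structure maps. The $\varphi$-internal hom is $$\mathscr{H}om^{\varphi}(M,N)=\pi_{2*}\mathscr{H}om_{\mathbf{P}\times\mathbf{P}}(\pi_1^{-1}M,\varphi^{-1}N).$$ It is contravariant left exact in $M$ and covariant left exact in $N$; $\mathbf{Ext}^i_\varphi$ denotes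 its right derived functors. In the claim $\mathbf{Ext}^1_\varphi(M,A)=H^1(\mathscr{H}om^\varphi(Q_\bullet,A))$ for a projective resolution $Q_\bullet\to M$. The subcomplex of boundaries of $K$ has terms $\operatorname{im} d_{n+1}\subseteq K_n$. $\mathscr{H}om^\varphi(K,A)$ is the cochain complex with terms $\mathscr{H}om^\varphi(K_n,A)$ in degree $n$ and differentials induced (up to sign) by $d$. *)

(* Defs.v *)
From HB Require Import structures.
From mathcomp Require Import all_boot all_order all_algebra.
From mathcomp Require Import boolp.

Set Implicit Arguments.
Unset Strict Implicit.
Unset Printing Implicit Defensive.

Import Order.TTheory GRing.Theory.
Local Open Scope ring_scope.
Local Open Scope quotient_scope.

Section SubQuotient.
Variables (k : fieldType) (V : lmodType k) (S : submodClosed V).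

Definition subspace : Type := {x : V | x \in S}.

HB.instance Definition _ := SubType.on subspace.
HB.instance Definition _ := Choice.on subspace.
HB.instance Definition _ := [SubChoice_isSubLmodule of subspace by <:].

Lemma submodN x : (- x \in S) = (x \in S).
Proof.
have SN y : y \in S -> - y \in S by rewrite -scaleN1r; apply: rpredZ.
by apply/idP/idP=> /SN; rewrite ?opprK.
Qed.

Definition cong (x y : V) : bool := x - y \in S.

Lemma cong_equiv : equiv_class_of cong.
Proof.
split=> [x|x y|y x z]; rewrite /cong.
- by rewrite subrr rpred0.
- by rewrite -opprB submodN.
- by move=> xy yz; rewrite -(subrKA y) rpredD.
Qed.

Canonical cong_equivRel := EquivRelPack cong_equiv.

Definition quotspace : Type := {eq_quot cong}.

HB.instance Definition _ := Choice.on quotspace.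
HB.instance Definition _ := EqQuotient.on quotspace.

Definition class (x : V) : quotspace := \pi_quotspace x.

Lemma classP x y : class x = class y <-> x - y \in S.
Proof. by split=> [/eqmodP|xy] //; apply/eqmodP. Qed.

Lemma class_surj (u : quotspace) : exists x, u = class x.
Proof. by exists (repr u); rewrite /class reprK. Qed.

Lemma repr_class x : repr (class x) - x \in S.
Proof. by apply/classP; rewrite /class reprK. Qed.

Definition qopp (u : quotspace) := class (- repr u).
Definition qadd (u v : quotspace) := class (repr u + repr v).
Definition qscale (a : k) (u : quotspace) := class (a *: repr u).

Lemma qoppE x : qopp (class x) = class (- x).
Proof. by apply/classP; rewrite -opprD submodN repr_class. Qed.

Lemma qaddE x y : qadd (class x) (class y) = class (x + y).
Proof. by apply/classP; rewrite opprD addrACA rpredD ?repr_class. Qed.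

Lemma qscaleE a x : qscale a (class x) = class (a *: x).
Proof. by apply/classP; rewrite -scalerBr rpredZ ?repr_class. Qed.

Lemma qaddA : associative qadd.
Proof.
move=> u v w; have [[x ->] [y ->] [z ->]] :=
  And3 (class_surj u) (class_surj v) (class_surj w).
by rewrite !qaddE addrA.
Qed.

Lemma qaddC : commutative qadd.
Proof.
move=> u v; have [[x ->] [y ->]] := conj (class_surj u) (class_surj v).
by rewrite !qaddE addrC.
Qed.

Lemma qadd0 : left_id (class 0) qadd.
Proof. by move=> u; have [x ->] := class_surj u; rewrite qaddE add0r. Qed.

Lemma qaddN : left_inverse (class 0) qopp qadd.
Proof. by move=> u; have [x ->] := class_surj u; rewrite qoppE qaddE addNr. Qed.

HB.instance Definition _ :=
  GRing.isZmodule.Build quotspace qaddA qaddC qadd0 qaddN.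

Lemma qscaleA a b u : qscale a (qscale b u) = qscale (a * b) u.
Proof. by have [x ->] := class_surj u; rewrite !qscaleE scalerA. Qed.

Lemma qscale1 : left_id 1 qscale.
Proof. by move=> u; have [x ->] := class_surj u; rewrite qscaleE scale1r. Qed.

Lemma qscaleDr : right_distributive qscale +%R.
Proof.
move=> a u v; have [[x ->] [y ->]] := conj (class_surj u) (class_surj v).
by rewrite [class x + _]qaddE !qscaleE scalerDr -qaddE.
Qed.

Lemma qscaleDl u : {morph qscale^~ u : a b / a + b}.
Proof.
by move=> a b; have [x ->] := class_surj u; rewrite !qscaleE scalerDl -qaddE.
Qed.

HB.instance Definition _ :=
  GRing.Zmodule_isLmodule.Build k quotspace qscaleA qscale1 qscaleDr qscaleDl.

Lemma class_is_linear : linear class.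
Proof. by move=> a x y; rewrite -qaddE -qscaleE. Qed.

HB.instance Definition _ := GRing.isLinear.Build k V quotspace *:%R class
  class_is_linear.

End SubQuotient.

Arguments class {k V} S x.

Section Subposet.
Variables (d : Order.disp_t) (Q : porderType d).

Definition subposet (D : pred Q) : Type := {x : Q | D x}.

HB.instance Definition _ D := SubType.on (subposet D).
HB.instance Definition _ D := Choice.on (subposet D).
HB.instance Definition _ D :=
  [SubChoice_isSubPOrder of subposet D by <: with d].

Definition subposet_incl (D : pred Q) (x : subposet D) : Q := val x.

Lemma subposet_incl_homo D : {homo @subposet_incl D : x y / (x <= y)%O}.
Proof. by move=> x y; rewrite -Order.le_val. Qed.

HB.instance Definition _ D :=
  Order.isOrderMorphism.Build d (subposet D) d Q _ (@subposet_incl_homo D).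

Definition subposet_widen (D E : pred Q) (DE : forall x, D x -> E x)
  (x : subposet D) : subposet E := exist _ (val x) (DE _ (valP x)).

Lemma subposet_widen_homo (D E : pred Q) (DE : forall x, D x -> E x) :
  {homo @subposet_widen D E DE : x y / (x <= y)%O}.
Proof. by move=> x y; rewrite -!Order.le_val. Qed.

Definition proj1 (x : Q *p Q) : Q := x.1.
Definition proj2 (x : Q *p Q) : Q := x.2.

Lemma proj1_homo : {homo proj1 : x y / (x <= y)%O}.
Proof. by move=> x y; rewrite Order.ProdOrder.leEprod => /andP[]. Qed.

Lemma proj2_homo : {homo proj2 : x y / (x <= y)%O}.
Proof. by move=> x y; rewrite Order.ProdOrder.leEprod => /andP[]. Qed.

HB.instance Definition _ := Order.isOrderMorphism.Build _ _ d Q proj1 proj1_homo.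
HB.instance Definition _ := Order.isOrderMorphism.Build _ _ d Q proj2 proj2_homo.

End Subposet.

Section PersistenceModule.
Variables (k : fieldType) (d : Order.disp_t) (P : porderType d).

(* As [<=] is boolean, the structure map does not depend on the proof of
   [p <= q]. *)
Record pmod := PMod {
  pobj :> P -> lmodType k;
  pstr : forall p q, (p <= q)%O -> pobj p -> pobj q;
  pstr_linear : forall p q (h : (p <= q)%O), linear (pstr h);
  pstr_id : forall p (h : (p <= p)%O) x, pstr h x = x;
  pstr_comp : forall p q r (pq : (p <= q)%O) (qr : (q <= r)%O) (pr : (p <= r)%O) x,
    pstr qr (pstr pq x) = pstr pr x
}.

Arguments pstr M {p q} h x : rename.
Arguments pstr_linear M {p q} h : rename.

HB.instance Definition _ (M : pmod) p q (h : (p <= q)%O) :=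
  GRing.isLinear.Build k (M p) (M q) *:%R (pstr M h) (pstr_linear M h).

Lemma pstr_irr (M : pmod) p q (h h' : (p <= q)%O) x : pstr M h x = pstr M h' x.
Proof. by rewrite (bool_irrelevance h h'). Qed.

Arguments pstr_irr M {p q} h h' x : rename.

Record pmor (M N : pmod) := PMor {
  pfun :> forall p, M p -> N p;
  pfun_linear : forall p, linear (@pfun p);
  pfun_nat : forall p q (h : (p <= q)%O) x, pfun (pstr M h x) = pstr N h (pfun x)
}.

Arguments pfun {M N} f p x : rename.
Arguments pfun_linear {M N} f p : rename.
Arguments pfun_nat {M N} f {p q} h x : rename.

HB.instance Definition _ M N (f : pmor M N) p :=
  GRing.isLinear.Build k (M p) (N p) *:%R (pfun f p) (pfun_linear f p).

Lemma pmor_ext M N (f g : pmor M N) : (forall p x, f p x = g p x) -> f = g.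
Proof.
case: f g => [f lf nf] [g lg ng] /= fg.
have efg : f = g by apply: functional_extensionality_dep => p; apply/funext.
by case: _ / efg lg ng => lg ng; congr PMor; apply: Prop_irrelevance.
Qed.

HB.instance Definition _ M N := gen_eqMixin (pmor M N).
HB.instance Definition _ M N := gen_choiceMixin (pmor M N).

Section Operations.
Variables M N : pmod.
Implicit Types f g : pmor M N.

Program Definition pmor0 : pmor M N := @PMor M N (fun _ _ => 0) _ _.
Next Obligation. by move=> a x y; rewrite scaler0 addr0. Qed.
Next Obligation. by rewrite linear0. Qed.

Program Definition pmorN f : pmor M N := @PMor M N (fun p x => - f p x) _ _.
Next Obligation. by move=> a x y; rewrite linearP opprD scalerN. Qed.
Next Obligation. by rewrite pfun_nat linearN. Qed.

Program Definition pmorD f g : pmor M N :=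
  @PMor M N (fun p x => f p x + g p x) _ _.
Next Obligation. by move=> a x y; rewrite !linearP scalerDr addrACA. Qed.
Next Obligation. by rewrite !pfun_nat linearD. Qed.

Program Definition pmorZ (a : k) f : pmor M N :=
  @PMor M N (fun p x => a *: f p x) _ _.
Next Obligation. by move=> b x y; rewrite linearP scalerDr !scalerA mulrC. Qed.
Next Obligation. by rewrite pfun_nat linearZ. Qed.

Lemma pmorDA : associative pmorD.
Proof. by move=> f g h; apply: pmor_ext => p x /=; rewrite addrA. Qed.
Lemma pmorDC : commutative pmorD.
Proof. by move=> f g; apply: pmor_ext => p x /=; rewrite addrC. Qed.
Lemma pmor0D : left_id pmor0 pmorD.
Proof. by move=> f; apply: pmor_ext => p x /=; rewrite add0r. Qed.
Lemma pmorND : left_inverse pmor0 pmorN pmorD.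
Proof. by move=> f; apply: pmor_ext => p x /=; rewrite addNr. Qed.

HB.instance Definition _ :=
  GRing.isZmodule.Build (pmor M N) pmorDA pmorDC pmor0D pmorND.

Lemma pmorZA a b f : pmorZ a (pmorZ b f) = pmorZ (a * b) f.
Proof. by apply: pmor_ext => p x /=; rewrite scalerA. Qed.
Lemma pmor1Z : left_id 1 pmorZ.
Proof. by move=> f; apply: pmor_ext => p x /=; rewrite scale1r. Qed.
Lemma pmorZDr : right_distributive pmorZ +%R.
Proof. by move=> a f g; apply: pmor_ext => p x /=; rewrite scalerDr. Qed.
Lemma pmorZDl f : {morph pmorZ^~ f : a b / a + b}.
Proof. by move=> a b; apply: pmor_ext => p x /=; rewrite scalerDl. Qed.

HB.instance Definition _ :=
  GRing.Zmodule_isLmodule.Build k (pmor M N) pmorZA pmor1Z pmorZDr pmorZDl.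

End Operations.

Program Definition pmor_id M : pmor M M := @PMor M M (fun _ x => x) _ _.
Next Obligation. by move=> a x y. Qed.

Program Definition pmor_comp L M N (g : pmor M N) (f : pmor L M) : pmor L N :=
  @PMor L N (fun p x => g p (f p x)) _ _.
Next Obligation. by move=> a x y; rewrite !linearP. Qed.
Next Obligation. by rewrite !pfun_nat. Qed.

Definition injective_pmor M N (f : pmor M N) := forall p, injective (f p).

Definition surjective_pmor M N (f : pmor M N) := forall p y, exists x, f p x = y.

Definition projective (M : pmod) := forall (X Y : pmod) (e : pmor X Y) (f : pmor M Y),
  surjective_pmor e -> exists g : pmor M X, pmor_comp e g = f.

Record submod (M : pmod) := Submod {
  smem :> forall p, submodClosed (M p);
  smem_str : forall p q (h : (p <= q)%O) x, x \in smem p -> pstr M h x \in smem q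
}.

Arguments smem {M} S p : rename.
Arguments smem_str {M} S {p q} h {x} xS : rename.

Section SubQuot.
Variables (M : pmod) (S : submod M).

Definition sub_str p q (h : (p <= q)%O) (x : subspace (S p)) : subspace (S q) :=
  exist _ (pstr M h (val x)) (smem_str S h (valP x)).

Program Definition psub : pmod := @PMod (fun p => subspace (S p)) sub_str _ _ _.
Next Obligation. by move=> a x y; apply: val_inj; rewrite /= !linearP. Qed.
Next Obligation. by apply: val_inj; rewrite /= pstr_id. Qed.
Next Obligation. by apply: val_inj; rewrite /= (pstr_comp _ _ pr). Qed.

Program Definition psub_incl : pmor psub M := @PMor psub M (fun p x => val x) _ _.
Next Obligation. by move=> a x y. Qed.

Definition quot_str p q (h : (p <= q)%O) (u : quotspace (S p)) : quotspace (S q) :=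
  class (S q) (pstr M h (repr u)).

Lemma quot_strE p q (h : (p <= q)%O) x :
  quot_str h (class (S p) x) = class (S q) (pstr M h x).
Proof. by apply/classP; rewrite -linearB smem_str ?repr_class. Qed.

Program Definition pquot : pmod := @PMod (fun p => quotspace (S p)) quot_str _ _ _.
Next Obligation.
move=> a u v; have [[x ->] [y ->]] := conj (class_surj u) (class_surj v).
by rewrite -linearP !quot_strE !linearP.
Qed.
Next Obligation. by have [y ->] := class_surj x; rewrite quot_strE pstr_id. Qed.
Next Obligation.
by have [y ->] := class_surj x; rewrite !quot_strE (pstr_comp _ _ pr).
Qed.

End SubQuot.

Section KerIm.
Variables (M N : pmod) (f : pmor M N).

Definition ker_mem p : {pred M p} := [pred x | f p x == 0].

Lemma ker_mem_closed p : submod_closed (@ker_mem p).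
Proof.
split=> [|a x y]; first by rewrite inE linear0.
by rewrite !inE linearP /= => /eqP-> /eqP->; rewrite scaler0 addr0.
Qed.

HB.instance Definition _ p :=
  GRing.isSubmodClosed.Build k (M p) (@ker_mem p) (ker_mem_closed p).

Program Definition pker : submod M := @Submod M (fun p => @ker_mem p) _.
Next Obligation. by move: H; rewrite !inE pfun_nat => /eqP->; rewrite linear0. Qed.

Definition im_mem p : {pred N p} := [pred y | `[< exists x, f p x = y >]].

Lemma im_mem_closed p : submod_closed (@im_mem p).
Proof.
split=> [|a x y]; rewrite !inE; first by apply/asboolP; exists 0; rewrite linear0.
move=> /asboolP[u <-] /asboolP[v <-].
by apply/asboolP; exists (a *: u + v); rewrite linearP.
Qed.

HB.instance Definition _ p :=
  GRing.isSubmodClosed.Build k (N p) (@im_mem p) (im_mem_closed p).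

Program Definition pim : submod N := @Submod N (fun p => @im_mem p) _.
Next Obligation.
move: H; rewrite !inE => /asboolP[u <-].
by apply/asboolP; exists (pstr M h u); rewrite pfun_nat.
Qed.

Definition preim_mem (S : submod N) p : {pred M p} := [pred x | f p x \in S p].

Lemma preim_mem_closed S p : submod_closed (@preim_mem S p).
Proof.
split=> [|a x y]; first by rewrite inE linear0 rpred0.
by rewrite !inE linearP => Sx Sy; rewrite rpredD ?rpredZ.
Qed.

HB.instance Definition _ S p :=
  GRing.isSubmodClosed.Build k (M p) (@preim_mem S p) (preim_mem_closed S p).

Program Definition ppreim (S : submod N) : submod M :=
  @Submod M (fun p => @preim_mem S p) _.
Next Obligation. by move: H; rewrite !inE pfun_nat => /smem_str->. Qed.

End KerIm.

Definition short_exact (L M N : pmod) (f : pmor L M) (g : pmor M N) :=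
  [/\ injective_pmor f,
      forall p y, y \in pim f p = (y \in pker g p)
    & surjective_pmor g].

(* The condition [g \o f = 0] is not needed to form the quotient of [ker g] by
   [im f], taken as the preimage of [im f] under the inclusion of [ker g]. *)
Definition homology (L M N : pmod) (f : pmor L M) (g : pmor M N) : pmod :=
  pquot (ppreim (psub_incl (pker g)) (pim f)).

Section HomologyMap.
Variables (L M N L' M' N' : pmod).
Variables (f : pmor L M) (g : pmor M N) (f' : pmor L' M') (g' : pmor M' N').
Variables (u : pmor L L') (v : pmor M M') (w : pmor N N').
Hypothesis vf : forall p x, v p (f p x) = f' p (u p x).
Hypothesis wg : forall p x, w p (g p x) = g' p (v p x).

Local Notation B := (ppreim (psub_incl (pker g)) (pim f)).
Local Notation B' := (ppreim (psub_incl (pker g')) (pim f')).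

Lemma ker_map_subproof p (x : subspace (pker g p)) : v p (val x) \in pker g' p.
Proof. by case: x => x /=; rewrite !inE -wg => /eqP->; rewrite linear0. Qed.

Definition ker_map p (x : subspace (pker g p)) : subspace (pker g' p) :=
  exist _ (v p (val x)) (ker_map_subproof x).

Lemma ker_map_linear p : linear (@ker_map p).
Proof. by move=> a x y; apply: val_inj; rewrite /= !linearP. Qed.

HB.instance Definition _ p :=
  GRing.isLinear.Build k _ _ *:%R (@ker_map p) (@ker_map_linear p).

Lemma ker_map_im p x : x \in B p -> ker_map x \in B' p.
Proof.
rewrite !inE /= => /asboolP[y yx]; apply/asboolP; exists (u p y).
by rewrite -vf yx.
Qed.

Definition homology_fun p (c : homology f g p) : homology f' g' p :=
  class (B' p) (ker_map (repr c)).

Lemma homology_funE p x : homology_fun (class (B p) x) = class (B' p) (ker_map x).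
Proof. by apply/classP; rewrite -linearB ker_map_im ?repr_class. Qed.

Program Definition homology_map : pmor (homology f g) (homology f' g') :=
  @PMor (homology f g) (homology f' g') homology_fun _ _.
Next Obligation.
move=> a c e; have [[x ->] [y ->]] := conj (class_surj c) (class_surj e).
by rewrite -linearP !homology_funE !linearP.
Qed.
Next Obligation.
have [y ->] := class_surj x; rewrite quot_strE !homology_funE quot_strE.
by congr class; apply: val_inj; rewrite /= pfun_nat.
Qed.

End HomologyMap.

Section Limit.
Variable F : pmod.

Record limit := Limit {
  lim_fun :> forall p, F p;
  lim_compat : forall p q (h : (p <= q)%O), pstr F h (lim_fun p) = lim_fun q
}.

Arguments lim_compat x {p q} h : rename.

Lemma limit_ext (x y : limit) : (forall p, x p = y p) -> x = y.
Proof.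
case: x y => [x cx] [y cy] /= xy.
have exy : x = y by apply: functional_extensionality_dep.
by case: _ / exy cy => cy; congr Limit; apply: Prop_irrelevance.
Qed.

HB.instance Definition _ := gen_eqMixin limit.
HB.instance Definition _ := gen_choiceMixin limit.

Program Definition lim0 := @Limit (fun _ => 0) _.
Next Obligation. by rewrite linear0. Qed.
Program Definition limN (x : limit) := @Limit (fun p => - x p) _.
Next Obligation. by rewrite linearN /= lim_compat. Qed.
Program Definition limD (x y : limit) := @Limit (fun p => x p + y p) _.
Next Obligation. by rewrite linearD /= !lim_compat. Qed.
Program Definition limZ (a : k) (x : limit) := @Limit (fun p => a *: x p) _.
Next Obligation. by rewrite linearZ /= lim_compat. Qed.

Lemma limDA : associative limD.
Proof. by move=> x y z; apply: limit_ext => p /=; rewrite addrA. Qed.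
Lemma limDC : commutative limD.
Proof. by move=> x y; apply: limit_ext => p /=; rewrite addrC. Qed.
Lemma lim0D : left_id lim0 limD.
Proof. by move=> x; apply: limit_ext => p /=; rewrite add0r. Qed.
Lemma limND : left_inverse lim0 limN limD.
Proof. by move=> x; apply: limit_ext => p /=; rewrite addNr. Qed.

HB.instance Definition _ := GRing.isZmodule.Build limit limDA limDC lim0D limND.

Lemma limZA a b x : limZ a (limZ b x) = limZ (a * b) x.
Proof. by apply: limit_ext => p /=; rewrite scalerA. Qed.
Lemma lim1Z : left_id 1 limZ.
Proof. by move=> x; apply: limit_ext => p /=; rewrite scale1r. Qed.
Lemma limZDr : right_distributive limZ +%R.
Proof. by move=> a x y; apply: limit_ext => p /=; rewrite scalerDr. Qed.
Lemma limZDl x : {morph limZ^~ x : a b / a + b}.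
Proof. by move=> a b; apply: limit_ext => p /=; rewrite scalerDl. Qed.

HB.instance Definition _ :=
  GRing.Zmodule_isLmodule.Build k limit limZA lim1Z limZDr limZDl.

End Limit.

Program Definition limit_map F G (f : pmor F G) (x : limit F) : limit G :=
  @Limit G (fun p => f p (x p)) _.
Next Obligation. by rewrite -pfun_nat lim_compat. Qed.

Lemma limit_map_linear F G (f : pmor F G) : linear (limit_map f).
Proof. by move=> a x y; apply: limit_ext => p /=; rewrite linearP. Qed.

End PersistenceModule.

Arguments pobj {k d P} M p : rename.
Arguments pstr {k d P} M {p q} h x : rename.
Arguments pstr_linear {k d P} M {p q} h : rename.
Arguments pstr_irr {k d P} M {p q} h h' x : rename.
Arguments pfun {k d P M N} f p x : rename.
Arguments pfun_linear {k d P M N} f p : rename.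
Arguments pfun_nat {k d P M N} f {p q} h x : rename.
Arguments smem {k d P M} S p : rename.
Arguments lim_compat {k d P F} x {p q} h : rename.

Section Functors.
Variable k : fieldType.

Program Definition pull d (P : porderType d) d' (Q : porderType d')
    (f : {omorphism P -> Q}) (G : pmod k Q) : pmod k P :=
  @PMod k d P (fun p => G (f p)) (fun p q h => pstr G (omorph_le f h)) _ _ _.
Next Obligation. exact: pstr_linear. Qed.
Next Obligation. exact: pstr_id. Qed.
Next Obligation. exact: pstr_comp. Qed.

Program Definition pull_map d (P : porderType d) d' (Q : porderType d')
    (f : {omorphism P -> Q}) (G G' : pmod k Q) (g : pmor G G') :
    pmor (pull f G) (pull f G') :=
  @PMor k d P (pull f G) (pull f G') (fun p => g (f p)) _ _.
Next Obligation. exact: pfun_linear. Qed.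
Next Obligation. exact: pfun_nat. Qed.

Definition restr d (Q : porderType d) (D : pred Q) (M : pmod k Q) :
  pmod k (subposet D) := pull (@subposet_incl d Q D) M.

Definition restr_map d (Q : porderType d) (D : pred Q) (M N : pmod k Q)
  (f : pmor M N) : pmor (restr D M) (restr D N) := pull_map _ f.

Section DirectImage.
Variables (d : Order.disp_t) (P : porderType d) (d' : Order.disp_t)
  (Q : porderType d') (f : {omorphism P -> Q}).

Definition above (q : Q) : pred P := fun p => (q <= f p)%O.

Lemma above_sub q q' : (q <= q')%O -> forall p, above q' p -> above q p.
Proof. by move=> qq' p; apply: le_trans. Qed.

Program Definition push_str (F : pmod k P) q q' (h : (q <= q')%O)
    (x : limit (restr (above q) F)) : limit (restr (above q') F) :=
  @Limit k _ _ (restr (above q') F) (fun p => x (subposet_widen (above_sub h) p)) _.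
Next Obligation.
rewrite -(lim_compat x (subposet_widen_homo (above_sub h) h0)).
exact: pstr_irr.
Qed.

Program Definition push (F : pmod k P) : pmod k Q :=
  @PMod k d' Q (fun q => limit (restr (above q) F)) (@push_str F) _ _ _.
Next Obligation. by move=> a x y; apply: limit_ext. Qed.
Next Obligation.
apply: limit_ext => -[s rs].
exact: (congr1 (fun e : above p s => x (exist _ s e) : F s) (Prop_irrelevance
  (above_sub h (valP (exist _ s rs))) rs)).
Qed.
Next Obligation.
apply: limit_ext => -[s rs].
exact: (congr1 (fun e : above p s => x (exist _ s e) : F s) (Prop_irrelevance
  (above_sub pq (valP (subposet_widen (above_sub qr) (exist _ s rs))))
  (above_sub pr (valP (exist _ s rs))))).
Qed.

Program Definition push_map (F G : pmod k P) (g : pmor F G) :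
    pmor (push F) (push G) :=
  @PMor k d' Q (push F) (push G) (fun q x => limit_map (restr_map (above q) g) x) _ _.
Next Obligation. exact: limit_map_linear. Qed.
Next Obligation. exact: limit_ext. Qed.

End DirectImage.

Section InternalHom.
Variables (d : Order.disp_t) (Q : porderType d).

Definition upset (q : Q) : pred Q := fun q' => (q <= q')%O.

Lemma upset_sub q q' : (q <= q')%O -> forall x, upset q' x -> upset q x.
Proof. by move=> qq' x; apply: le_trans. Qed.

Program Definition ihom_str (M N : pmod k Q) q q' (h : (q <= q')%O)
    (f : pmor (restr (upset q) M) (restr (upset q) N)) :
    pmor (restr (upset q') M) (restr (upset q') N) :=
  @PMor k _ _ (restr (upset q') M) (restr (upset q') N)
    (fun x => f (subposet_widen (upset_sub h) x)) _ _.
Next Obligation. exact: (pfun_linear f (subposet_widen (upset_sub h) p)). Qed.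
Next Obligation.
have E := pfun_nat f (subposet_widen_homo (upset_sub h) h0) x.
apply: etrans (etrans E (pstr_irr N _ _ _)).
exact: (congr1 (pfun f (subposet_widen (upset_sub h) q0)) (pstr_irr M _ _ x)).
Qed.

Program Definition ihom (M N : pmod k Q) : pmod k Q :=
  @PMod k d Q (fun q => pmor (restr (upset q) M) (restr (upset q) N))
    (@ihom_str M N) _ _ _.
Next Obligation. by move=> a f g; apply: pmor_ext. Qed.
Next Obligation.
apply: pmor_ext => -[s rs] y.
exact: (congr1 (fun e : upset p s => x (exist _ s e) y : N s) (Prop_irrelevance
  (upset_sub h (valP (exist _ s rs))) rs)).
Qed.
Next Obligation.
apply: pmor_ext => -[s rs] y.
exact: (congr1 (fun e : upset p s => x (exist _ s e) y : N s) (Prop_irrelevance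
  (upset_sub pq (valP (subposet_widen (upset_sub qr) (exist _ s rs))))
  (upset_sub pr (valP (exist _ s rs))))).
Qed.

Program Definition ihom_map (M M' N N' : pmod k Q) (f : pmor M' M)
    (g : pmor N N') : pmor (ihom M N) (ihom M' N') :=
  @PMor k d Q (ihom M N) (ihom M' N')
    (fun q h => pmor_comp (restr_map _ g) (pmor_comp h (restr_map _ f))) _ _.
Next Obligation. by move=> a h1 h2; apply: pmor_ext => s x /=; rewrite linearP. Qed.
Next Obligation. exact: pmor_ext. Qed.

End InternalHom.

End Functors.

Section PhiHom.
Variables (k : fieldType) (d : Order.disp_t) (P : porderType d).
Variable phi : {omorphism P *p P -> P}.

Definition phihom (M N : pmod k P) : pmod k P :=
  push (@proj2 d P) (ihom (pull (@proj1 d P) M) (pull phi N)).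

Definition phihom_map (M M' N N' : pmod k P) (f : pmor M' M) (g : pmor N N') :
    pmor (phihom M N) (phihom M' N') :=
  push_map _ (ihom_map (pull_map _ f) (pull_map phi g)).

End PhiHom.

Section Complexes.
Variables (k : fieldType) (d : Order.disp_t) (P : porderType d).

(* A [Z]-graded complex is given by morphisms [dif i j] between all pairs of
   terms, which vanish unless [c i j]: [j + 1 == i] for chain complexes and
   [i + 1 == j] for cochain complexes.  This avoids transports along identities
   such as [i - 1 + 1 = i]. *)
Record complex (c : rel int) := Complex {
  cobj :> int -> pmod k P;
  dif : forall i j, pmor (cobj i) (cobj j);
  dif_shape : forall i j, ~~ c i j -> dif i j = 0;
  dif_dif : forall h i j, pmor_comp (dif i j) (dif h i) = 0
}.

Arguments dif {c} K i j : rename.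
Arguments dif_shape {c} K {i j} : rename.
Arguments dif_dif {c} K h i j : rename.

Lemma dif_difE c (K : complex c) h i j p x : dif K i j p (dif K h i p x) = 0.
Proof. exact: (congr1 (fun f : pmor _ _ => f p x) (dif_dif K h i j)). Qed.

Definition down : rel int := fun i j => j + 1 == i.
Definition up : rel int := fun i j => i + 1 == j.

Notation chain_complex := (complex down).
Notation cochain_complex := (complex up).

Record cmor c (K L : complex c) := CMor {
  cfun :> forall i, pmor (K i) (L i);
  cfun_dif : forall i j, pmor_comp (cfun j) (dif K i j) = pmor_comp (dif L i j) (cfun i)
}.

Lemma cfun_difE c (K L : complex c) (f : cmor K L) i j p x :
  f j p (dif K i j p x) = dif L i j p (f i p x).
Proof. exact: (congr1 (fun h : pmor _ _ => h p x) (cfun_dif f i j)). Qed.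

Arguments cfun_difE {c K L} f i j p x.

Definition boundaries (K : chain_complex) (n : int) : pmod k P :=
  psub (pim (dif K (n + 1) n)).

Definition chain_homology (n : int) (K : chain_complex) : pmod k P :=
  homology (dif K (n + 1) n) (dif K n (n - 1)).

Definition chain_homology_map (n : int) (K L : chain_complex) (f : cmor K L) :
    pmor (chain_homology n K) (chain_homology n L) :=
  homology_map (cfun_difE f (n + 1) n) (cfun_difE f n (n - 1)).

Definition cohomology (n : int) (C : cochain_complex) : pmod k P :=
  homology (dif C (n - 1) n) (dif C n (n + 1)).

Definition cohomology_map (n : int) (C D : cochain_complex) (f : cmor C D) :
    pmor (cohomology n C) (cohomology n D) :=
  homology_map (cfun_difE f (n - 1) n) (cfun_difE f n (n + 1)).

Record proj_resolution (M : pmod k P) := ProjResolution {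
  res_complex :> chain_complex;
  res_neg : forall n p (x : res_complex n p), n < 0 -> x = 0;
  res_proj : forall n, projective (res_complex n);
  res_aug : pmor (res_complex 0) M;
  res_aug_surj : surjective_pmor res_aug;
  res_exact0 : forall p x,
    (x \in pker res_aug p) = (x \in pim (dif res_complex 1 0) p);
  res_exact : forall n : int, 0 < n -> forall p x,
    (x \in pker (dif res_complex n (n - 1)) p) =
    (x \in pim (dif res_complex (n + 1) n) p)
}.

Definition is_lift (M M' : pmod k P) (Q : proj_resolution M)
    (Q' : proj_resolution M') (f : pmor M M') (F : cmor Q Q') :=
  pmor_comp (res_aug Q') (F 0) = pmor_comp f (res_aug Q).

Section Phi.
Variable phi : {omorphism P *p P -> P}.

(* No signs are inserted in the differentials: they change neither the kernels
   nor the images. *)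
Program Definition phihom_cochain (K : chain_complex) (A : pmod k P) :
    cochain_complex :=
  @Complex up (fun n => phihom phi (K n) A)
    (fun i j => phihom_map phi (dif K j i) (pmor_id A)) _ _.
Next Obligation.
rewrite (dif_shape K H).
by apply: pmor_ext => p x; apply: limit_ext => q; apply: pmor_ext => r y;
  rewrite /= linear0.
Qed.
Next Obligation.
apply: pmor_ext => p x; apply: limit_ext => q; apply: pmor_ext => r y /=.
by rewrite dif_difE linear0.
Qed.

Program Definition phihom_cochain_map (K K' : chain_complex) (A A' : pmod k P)
    (f : cmor K K') (g : pmor A A') :
    cmor (phihom_cochain K' A) (phihom_cochain K A') :=
  @CMor up (phihom_cochain K' A) (phihom_cochain K A')
    (fun n => phihom_map phi (f n) g) _.
Next Obligation.
apply: pmor_ext => p x; apply: limit_ext => q; apply: pmor_ext => r y /=.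
by rewrite cfun_difE.
Qed.

(* [Ext i Q A] is [Ext^i_phi(M, A)] computed from the projective resolution
   [Q] of [M]. *)
Definition Ext (i : nat) (M : pmod k P) (Q : proj_resolution M) (A : pmod k P) :
    pmod k P :=
  cohomology i (phihom_cochain Q A).

Definition Ext_map (i : nat) (M M' : pmod k P) (Q : proj_resolution M)
    (Q' : proj_resolution M') (A A' : pmod k P) (F : cmor Q Q') (g : pmor A A') :
    pmor (Ext i Q' A) (Ext i Q A') :=
  cohomology_map i (phihom_cochain_map F g).

End Phi.

End Complexes.

Section UniversalCoefficients.
Variables (k : fieldType) (d : Order.disp_t) (P : porderType d).
Variables (phi : {omorphism P *p P -> P}) (n : nat).

Record uct_complex := UctComplex {
  uct_cplx :> complex k P down;
  uct_terms : forall i, projective (uct_cplx i);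
  uct_boundaries : forall i, projective (boundaries uct_cplx i)
}.

Definition uct_left := forall (K : uct_complex) (A : pmod k P)
    (Q : proj_resolution (chain_homology (n%:Z - 1) K)),
  pmor (Ext phi 1 Q A) (cohomology n (phihom_cochain phi K A)).

Definition uct_right := forall (K : uct_complex) (A : pmod k P),
  pmor (cohomology n (phihom_cochain phi K A)) (phihom phi (chain_homology n K) A).

(* Exactness and naturality in [K] and [A].  On the [Ext] term a chain map
   [f : K -> K'] acts through any lift of [H_{n-1}(f)] to the resolutions. *)
Record natural_ses (iota : uct_left) (pi : uct_right) : Prop := NaturalSes {
  ses_exact : forall K A Q, short_exact (iota K A Q) (pi K A);
  ses_iota_natural : forall (K K' : uct_complex) (f : cmor K K')
      (A A' : pmod k P) (g : pmor A A')
      (Q : proj_resolution (chain_homology (n%:Z - 1) K))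
      (Q' : proj_resolution (chain_homology (n%:Z - 1) K')) (F : cmor Q Q'),
    is_lift (chain_homology_map (n%:Z - 1) f) F ->
    pmor_comp (cohomology_map n (phihom_cochain_map phi f g)) (iota K' A Q') =
    pmor_comp (iota K A' Q) (Ext_map phi 1 F g);
  ses_pi_natural : forall (K K' : uct_complex) (f : cmor K K')
      (A A' : pmod k P) (g : pmor A A'),
    pmor_comp (phihom_map phi (chain_homology_map n f) g) (pi K' A) =
    pmor_comp (pi K A') (cohomology_map n (phihom_cochain_map phi f g))
}.

Definition is_section (M N : pmod k P) (g : pmor M N) (s : pmor N M) :=
  pmor_comp g s = pmor_id N.

Definition splitting_natural (A : pmod k P)
    (s : forall K : uct_complex,
      pmor (phihom phi (chain_homology n K) A) (cohomology n (phihom_cochain phi K A))) :=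
  forall (K K' : uct_complex) (f : cmor K K'),
    pmor_comp (cohomology_map n (phihom_cochain_map phi f (pmor_id A))) (s K') =
    pmor_comp (s K) (phihom_map phi (chain_homology_map n f) (pmor_id A)).

End UniversalCoefficients.

(* Main.v *)
Require Import Defs.
From mathcomp Require Import all_boot all_order all_algebra.
From HB Require Import structures.
From mathcomp Require Import boolp.

Set Implicit Arguments.
Unset Strict Implicit.
Unset Printing Implicit Defensive.

Import Order.TTheory GRing.Theory Num.Theory.
Local Open Scope ring_scope.

(** Write [F = phihom phi _ A], a contravariant, linear and left exact functor.
As the boundaries of [K] are projective, every inclusion of cycles [Z_i -> K_i]
has a retraction ([cycles_retract]), so the cycles are projective too.

The right-hand map restricts a cocycle [K_n -> A] to [Z_n] and lets it descend
to [H_n] ([uct_right_ex]).  Composing with [K_n -> Z_n -> H_n], where the first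
map is a retraction, is a section of it ([uct_right_section]); the retraction
is chosen, hence the splitting is not natural.

For the left-hand map, [K_n -> Z_{n-1} -> H_{n-1}] and [Q_1 -> Q_0 -> H_{n-1}]
are two projective presentations of the same module.  Two lifts of a morphism
to presentations differ by a homotopy ([pres_mor_homotopic]), so the group of
maps [rels -> A] that kill the kernel of [rels -> gens], modulo the maps that
factor through [gens], depends on the presented module only, and functorially
so ([precomp_homotopic]).  For [Q] this group is [Ext^1].  For [K] the maps in
question are those vanishing on [Z_n], and they are exactly the cocycles whose
image in [F H_n] is zero; factoring through [Z_{n-1}] is the same as factoring
through [K_{n-1}] because of the retraction ([cycles_coboundary]).  This gives
injectivity ([uct_left_inj]), exactness ([uct_exact]) and naturality
([uct_left_natural]) by three uses of the same homotopy lemma.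

No natural splitting exists over the poset [false < true], for [phi] the first
projection and [n = 1].  Let [k_q] be the free module on a generator in degree
[q], let [f : K -> K'] be the identity in degree 1 between the inclusion
[K = (k_true -> k_false)] and [K' = (k_true -> 0)], and take [A = k_true].
Then [H_1 K = 0], so a natural section [s] would satisfy
[f^* s_{K'} = s_K (H_1 f)^* = 0].  But [H_0 K' = 0] makes [s_{K'}] the inverse
of an isomorphism, while [f^*] sends the class of the identity [k_true -> A] to
a nonzero element, since the identity of [k_true] does not extend to
[k_false] ([ex_not_coboundary]). *)

(** * Factorizations and retractions of persistence modules *)
Section Modules.
Variables (k : fieldType) (d : Order.disp_t) (P : porderType d).
Implicit Types (L M N X Y : pmod k P).

Lemma pfunP M N (f : pmor M N) p a x y : f p (a *: x + y) = a *: f p x + f p y.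
Proof. exact: linearP. Qed.

Lemma pfunB M N (f : pmor M N) p x y : f p (x - y) = f p x - f p y.
Proof. exact: linearB. Qed.

Lemma pfun0 M N (f : pmor M N) p : f p 0 = 0.
Proof. exact: linear0. Qed.

Lemma mem_kerE M N (f : pmor M N) p x : (x \in pker f p) = (f p x == 0).
Proof. by []. Qed.

Lemma mem_imP M N (f : pmor M N) p y :
  reflect (exists x, f p x = y) (y \in pim f p).
Proof. by rewrite inE; apply: asboolP. Qed.

Section Corestrict.
Variables (X M : pmod k P) (S : submod M) (f : pmor X M).
Hypothesis fS : forall p x, f p x \in S p.

Program Definition corestrict : pmor X (psub S) :=
  @PMor _ _ _ X (psub S) (fun p x => exist _ (f p x) (fS x)) _ _.
Next Obligation. by move=> a x y; apply: val_inj; rewrite /= pfunP. Qed.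
Next Obligation. by apply: val_inj; rewrite /= pfun_nat. Qed.

End Corestrict.

Lemma psub_elt M (S : submod M) p x : x \in S p -> exists z : psub S p, val z = x.
Proof. by move=> xS; exists (exist (fun x => x \in S p) x xS : subspace _). Qed.

Lemma im_mem_fun M N (f : pmor M N) p x : f p x \in pim f p.
Proof. by apply/mem_imP; exists x. Qed.

(** The values are chosen, and uniqueness of preimages under [m] makes the
choice linear and natural. *)
Lemma factor_mono X Y Z' (f : pmor X Z') (m : pmor Y Z') :
    injective_pmor m -> (forall p x, exists y, m p y = f p x) ->
  exists g : pmor X Y, forall p x, m p (g p x) = f p x.
Proof.
move=> m_inj im_f.
pose g p x := projT1 (cid (im_f p x)).
have gE p x : m p (g p x) = f p x by rewrite /g; case: cid.
have lin p : linear (g p).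
  by move=> a x y; apply: (m_inj p); rewrite pfunP !gE pfunP.
have nat p q (h : (p <= q)%O) x : g q (pstr X h x) = pstr Y h (g p x).
  by apply: (m_inj q); rewrite pfun_nat !gE pfun_nat.
by exists (PMor lin nat).
Qed.

(** Values are computed on chosen preimages; the condition on kernels makes the
result independent of the choice, hence linear and natural. *)
Lemma factor_epi X Y Z' (e : pmor X Y) (f : pmor X Z') :
    surjective_pmor e -> (forall p x, e p x = 0 -> f p x = 0) ->
  exists g : pmor Y Z', forall p x, g p (e p x) = f p x.
Proof.
move=> e_surj ker_f.
pose r p y := projT1 (cid (e_surj p y)).
have rE p y : e p (r p y) = y by rewrite /r; case: cid.
have fE p x x' : e p x = e p x' -> f p x = f p x'.
  move=> exx'; apply/eqP; rewrite -subr_eq0 -pfunB ker_f //.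
  by rewrite pfunB exx' subrr.
have lin p : linear (fun y => f p (r p y)).
  by move=> a x y; rewrite -pfunP; apply: fE; rewrite pfunP !rE.
have nat p q (h : (p <= q)%O) x : f q (r q (pstr Y h x)) = pstr Z' h (f p (r p x)).
  by rewrite -pfun_nat; apply: fE; rewrite pfun_nat !rE.
by exists (PMor lin nat) => p x /=; apply: fE; rewrite rE.
Qed.

(** Projectivity in the form used below: [e] is surjective onto its image, so
a morphism into the image lifts. *)
Lemma lift_im M X Y (e : pmor X Y) (f : pmor M Y) :
    projective M -> (forall p x, exists y, e p y = f p x) ->
  exists g : pmor M X, forall p x, e p (g p x) = f p x.
Proof.
move=> projM fe.
have f_im p x : f p x \in pim e p by apply/mem_imP.
have e_surj : surjective_pmor (corestrict (im_mem_fun e)).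
  move=> p [y ye]; case/mem_imP: (ye) => x xy; exists x; exact: val_inj.
have [g eg] := projM _ _ _ (corestrict f_im) e_surj.
by exists g => p x; have /= [] := congr1 (fun h : pmor _ _ => h p x) eg.
Qed.

Lemma projective_retract M N (i : pmor N M) (r : pmor M N) :
  (forall p x, r p (i p x) = x) -> projective M -> projective N.
Proof.
move=> ri projM X Y e f e_surj.
have [g eg] := projM _ _ e (pmor_comp f r) e_surj.
exists (pmor_comp g i); apply: pmor_ext => p x /=.
by have /= -> := congr1 (fun h : pmor _ _ => h p (i p x)) eg; rewrite ri.
Qed.

(** A section [s] of [f] over its image gives the retraction [x - s (f x)]. *)
Lemma cycles_retract M N (f : pmor M N) :
    projective (psub (pim f)) ->
  exists r : pmor M (psub (pker f)), forall p z, r p (val z) = z.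
Proof.
move=> projB.
have [|s fs] := @lift_im _ _ _ f (psub_incl (pim f)) projB.
  by move=> p y; apply/mem_imP/(valP y).
pose f' := corestrict (im_mem_fun f).
have r_ker p x : (pmor_id M - pmor_comp s f' : pmor M M) p x \in pker f p.
  by rewrite mem_kerE /= pfunB fs /= subrr.
exists (corestrict r_ker) => p z; apply: val_inj => /=.
have /eqP fz0 : f p (val z) == 0 by exact: (valP z).
have -> : exist _ (f p (val z)) (im_mem_fun f (val z)) = 0 :> psub (pim f) p.
  exact: val_inj.
by rewrite pfun0 subr0.
Qed.

Program Definition quot_map M (S : submod M) : pmor M (pquot S) :=
  @PMor _ _ _ M (pquot S) (fun p x => class (S p) x) _ _.
Next Obligation. by move=> a x y; rewrite linearP. Qed.
Next Obligation. by rewrite quot_strE. Qed.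

Lemma quot_map_surj M (S : submod M) : surjective_pmor (quot_map S).
Proof. by move=> p y; have [x ->] := class_surj y; exists x. Qed.

Lemma quot_map_eq0 M (S : submod M) p x : quot_map S p x = 0 <-> x \in S p.
Proof.
rewrite -(pfun0 (quot_map S) p); split=> [/classP|xS]; first by rewrite subr0.
by apply/classP; rewrite subr0.
Qed.

Section Homology.
Variables (L M N : pmod k P) (f : pmor L M) (g : pmor M N).

Definition hclass : pmor (psub (pker g)) (homology f g) := quot_map _.

Lemma hclass_surj : surjective_pmor hclass.
Proof. exact: quot_map_surj. Qed.

Lemma hclass_eq0 p x : hclass p x = 0 <-> exists u, f p u = val x.
Proof. by rewrite quot_map_eq0 inE /= inE; split=> /asboolP. Qed.

Lemma hclassP p x y : hclass p x = hclass p y <-> exists u, f p u = val x - val y.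
Proof.
rewrite -(hclass_eq0 (x - y)) pfunB; split=> [->|/eqP]; first exact: subrr.
by rewrite subr_eq0 => /eqP.
Qed.

End Homology.

Lemma homology_map_class L M N L' M' N' (f : pmor L M) (g : pmor M N)
    (f' : pmor L' M') (g' : pmor M' N') (u : pmor L L') (v : pmor M M') (w : pmor N N')
    (vf : forall p x, v p (f p x) = f' p (u p x))
    (wg : forall p x, w p (g p x) = g' p (v p x)) p x :
  homology_map vf wg p (hclass f g p x) = hclass f' g' p (ker_map wg x).
Proof. exact: (homology_funE vf wg). Qed.

End Modules.

(** * Elements of the internal hom *)
Section PhiHom.
Variables (k : fieldType) (d : Order.disp_t) (P : porderType d).
Variable phi : {omorphism P *p P -> P}.
Implicit Types (M N A : pmod k P).

(** An element of [phihom phi M A] at [p] is a compatible family, over the pairs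
[s] whose second component is above [p], of natural transformations on the
pairs [t] above [s].  All identities between such elements are checked on the
linear maps [ev x s t], so that maps with values in the internal hom are
handled as maps [M -> A]. *)
Definition ev M A p (x : phihom phi M A p) (s : subposet (above (@proj2 d P) p))
    (t : subposet (upset (subposet_incl s))) :
    M (proj1 (subposet_incl t)) -> A (phi (subposet_incl t)) :=
  pfun (lim_fun x s : pmor (restr _ (pull (@proj1 d P) M)) (restr _ (pull phi A))) t.

Arguments ev {M A p} x s t m.

Lemma ev_linear M A p x s t : linear (@ev M A p x s t).
Proof. exact: (pfun_linear (lim_fun x s : pmor _ _)). Qed.

HB.instance Definition _ M A p x s t :=
  GRing.isLinear.Build k _ _ *:%R (@ev M A p x s t) (@ev_linear M A p x s t).

Lemma phihom_ext M A p (x y : phihom phi M A p) :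
  (forall s t m, ev x s t m = ev y s t m) -> x = y.
Proof. by move=> xy; apply: limit_ext => s; apply: pmor_ext => t m; apply: xy. Qed.

Lemma evB M A p (x y : phihom phi M A p) s t m :
  ev (x - y) s t m = ev x s t m - ev y s t m.
Proof. by []. Qed.

Lemma ev0 M A p s t m : @ev M A p 0 s t m = 0.
Proof. by []. Qed.

Lemma ev_map M M' A A' (f : pmor M' M) (g : pmor A A') p x s t m :
  ev (phihom_map phi f g p x : phihom phi M' A' p) s t m = g _ (ev x s t (f _ m)).
Proof. by []. Qed.

Definition precomp M M' A (f : pmor M' M) : pmor (phihom phi M A) (phihom phi M' A) :=
  phihom_map phi f (pmor_id A).

Lemma ev_precomp M M' A (f : pmor M' M) p (x : phihom phi M A p) s t m :
  ev (precomp A f p x : phihom phi M' A p) s t m = ev x s t (f _ m).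
Proof. by []. Qed.

(** Stated for arbitrary proofs [hM] and [hA], so as to apply to structure maps
written with any of them. *)
Lemma ev_nat M A p (x : phihom phi M A p) s t t' (tt' : (t <= t')%O)
    (hM : (proj1 (subposet_incl t) <= proj1 (subposet_incl t'))%O)
    (hA : (phi (subposet_incl t) <= phi (subposet_incl t'))%O) m :
  ev x s t' (pstr M hM m) = pstr A hA (ev x s t m).
Proof.
pose xs : pmor (restr (upset (subposet_incl s)) (pull (@proj1 d P) M))
               (restr (upset (subposet_incl s)) (pull phi A)) := lim_fun x s.
have tt'P := omorph_le (@subposet_incl _ _ (upset (subposet_incl s))) tt'.
rewrite (bool_irrelevance hM (omorph_le (@proj1 d P) tt'P)).
rewrite (bool_irrelevance hA (omorph_le phi tt'P)).
rewrite (bool_irrelevance tt'P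
  (omorph_le (@subposet_incl _ _ (upset (subposet_incl s))) tt')).
exact: (pfun_nat xs tt' m).
Qed.

(** Together with [precomp_factor], this is left exactness in the first
argument. *)
Lemma precomp_inj M N A (e : pmor M N) :
  surjective_pmor e -> injective_pmor (precomp A e).
Proof.
move=> e_surj p x y xy; apply: phihom_ext => s t n; have [m <-] := e_surj _ n.
by rewrite -!ev_precomp xy.
Qed.

Lemma precomp_factor M N A (e : pmor M N) p (x : phihom phi M A p) :
    surjective_pmor e -> (forall s t m, e _ m = 0 -> ev x s t m = 0) ->
  exists y : phihom phi N A p, precomp A e p y = x.
Proof.
move=> e_surj ker_x.
have ex_y (s : subposet (above (@proj2 d P) p)) :
  exists y : pmor (restr (upset (subposet_incl s)) (pull (@proj1 d P) N))
                  (restr (upset (subposet_incl s)) (pull phi A)),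
    forall t m, y t (e (proj1 (subposet_incl t)) m) = ev x s t m.
  pose e' := restr_map (upset (subposet_incl s)) (pull_map (@proj1 d P) e).
  have e'_surj : surjective_pmor e' by move=> t; apply: e_surj.
  by have [t m|y yE] := @factor_epi _ _ _ _ _ _ e' (lim_fun x s) e'_surj;
    [apply: ker_x | exists y => t m; apply: yE].
pose y s := projT1 (cid (ex_y s)).
have yE s t m : y s t (e (proj1 (subposet_incl t)) m) = ev x s t m.
  by rewrite /y; case: cid => ? yE; apply: yE.
have compat s s' (h : (s <= s')%O) :
  pstr (restr (above (@proj2 d P) p) (ihom (pull (@proj1 d P) N) (pull phi A))) h
    (y s) = y s'.
  apply: pmor_ext => t n; have [m <-] := e_surj (proj1 (subposet_incl t)) n.
  by rewrite [RHS]yE /ev -(lim_compat x h) [LHS]yE.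
by exists (Limit compat); apply: phihom_ext => s t m; rewrite ev_precomp -yE.
Qed.

End PhiHom.

Arguments ev {k d P phi M A p} x s t m.
Arguments ev_precomp {k d P phi M M' A} f {p} x s t m.
Arguments ev_map {k d P phi M M' A A'} f g {p} x s t m.

(** * Projective presentations and their comparison *)
Section Presentations.
Variables (k : fieldType) (d : Order.disp_t) (P : porderType d).
Implicit Types (H A : pmod k P).

Record presentation H := Presentation {
  gens : pmod k P;
  rels : pmod k P;
  gens_proj : projective gens;
  rels_proj : projective rels;
  rel_map : pmor rels gens;
  gen_map : pmor gens H;
  gen_map_surj : surjective_pmor gen_map;
  gen_map_eq0 : forall p x, gen_map p x = 0 <-> exists y, rel_map p y = x
}.

Lemma gen_rel H (R : presentation H) p y : gen_map R p (rel_map R p y) = 0.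
Proof. by apply/gen_map_eq0; exists y. Qed.

Record pres_mor H H' (R : presentation H) (R' : presentation H') (h : pmor H H') :=
  PresMor {
    on_gens : pmor (gens R) (gens R');
    on_rels : pmor (rels R) (rels R');
    on_gensE : forall p x, gen_map R' p (on_gens p x) = h p (gen_map R p x);
    on_relsE : forall p y, rel_map R' p (on_rels p y) = on_gens p (rel_map R p y)
  }.

Program Definition pres_id H (R : presentation H) : pres_mor R R (pmor_id H) :=
  @PresMor _ _ _ _ _ (pmor_id _) (pmor_id _) _ _.

Program Definition pres_comp H H' H'' (R : presentation H) (R' : presentation H')
    (R'' : presentation H'') (h : pmor H H') (h' : pmor H' H'')
    (c' : pres_mor R' R'' h') (c : pres_mor R R' h) :
    pres_mor R R'' (pmor_comp h' h) :=
  @PresMor _ _ _ _ _ (pmor_comp (on_gens c') (on_gens c))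
    (pmor_comp (on_rels c') (on_rels c)) _ _.
Next Obligation. by rewrite !on_gensE. Qed.
Next Obligation. by rewrite !on_relsE. Qed.

(** Lift twice: [h] along the surjection [gen_map R'], then the result along
[rel_map R'], whose image is the kernel of [gen_map R']. *)
Lemma pres_mor_ex H H' (R : presentation H) (R' : presentation H') (h : pmor H H') :
  inhabited (pres_mor R R' h).
Proof.
have [p x|c0 c0E] := @lift_im _ _ _ _ _ _ (gen_map R') (pmor_comp h (gen_map R))
  (@gens_proj _ R); first exact: gen_map_surj.
have [p y|c1 c1E] := @lift_im _ _ _ _ _ _ (rel_map R') (pmor_comp c0 (rel_map R))
  (@rels_proj _ R).
  by apply/gen_map_eq0; rewrite /= c0E /= gen_rel pfun0.
exact: inhabits (PresMor c0E c1E).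
Qed.

(** The difference of the maps on generators lands in the kernel of
[gen_map R'], hence lifts to [s : gens R -> rels R'].  As [rel_map R'] need not
be injective, the homotopy identity on relations only holds up to its kernel.
The morphisms [h] and [h'] are compared pointwise so that composites such as
[pmor_comp (pmor_id _) h] and [pmor_comp h (pmor_id _)] need no conversion. *)
Lemma pres_mor_homotopic H H' (R : presentation H) (R' : presentation H')
    (h h' : pmor H H') (c : pres_mor R R' h) (c' : pres_mor R R' h') :
    (forall p x, h p x = h' p x) ->
  exists s : pmor (gens R) (rels R'), forall p y,
    rel_map R' p (on_rels c p y - on_rels c' p y - s p (rel_map R p y)) = 0.
Proof.
move=> hh'; pose w : pmor (gens R) (gens R') := on_gens c - on_gens c'.
have [p x|s sE] := @lift_im _ _ _ _ _ _ (rel_map R') w (@gens_proj _ R).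
  by apply/gen_map_eq0; rewrite /w /= pfunB !on_gensE hh' subrr.
by exists s => p y; rewrite !pfunB sE !on_relsE subrr.
Qed.

Variable phi : {omorphism P *p P -> P}.

(** For a presentation these are the [1]-cocycles: a resolution extending it
has [rel_map R] as first differential, and the image of the second one is the
kernel of [rel_map R]. *)
Definition kills_ker M N A (f : pmor M N) p (x : phihom phi M A p) :=
  forall s t m, f _ m = 0 -> ev x s t m = 0.

(** Homotopic morphisms induce the same map on [Ext^1]: a map killing the
kernel of [rel_map R'] does not see the defect in [pres_mor_homotopic], so the
two composites differ by the coboundary of [x] composed with the homotopy. *)
Lemma precomp_homotopic H H' (R : presentation H) (R' : presentation H')
    (h h' : pmor H H') (c : pres_mor R R' h) (c' : pres_mor R R' h') A A'
    (g : pmor A A') p (x : phihom phi (rels R') A p) :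
    (forall p x, h p x = h' p x) -> kills_ker (rel_map R') x ->
  exists u : phihom phi (gens R) A' p, precomp phi A' (rel_map R) p u =
    phihom_map phi (on_rels c) g p x - phihom_map phi (on_rels c') g p x.
Proof.
move=> hh' ker_x; have [s sE] := pres_mor_homotopic c c' hh'.
exists (phihom_map phi s g p x); apply: phihom_ext => e t m.
rewrite evB ev_precomp !ev_map -pfunB -linearB; congr (g _ _).
apply/esym/eqP; rewrite -subr_eq0 -linearB; apply/eqP.
exact: ker_x (sE _ _).
Qed.

Lemma pres_mor_kills H H' (R : presentation H) (R' : presentation H')
    (h : pmor H H') (c : pres_mor R R' h) A A' (g : pmor A A') p
    (x : phihom phi (rels R') A p) :
    kills_ker (rel_map R') x ->
  kills_ker (rel_map R) (phihom_map phi (on_rels c) g p x : phihom phi (rels R) A' p).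
Proof.
move=> ker_x s t m m0; rewrite ev_map ker_x ?pfun0 //.
by rewrite on_relsE m0 pfun0.
Qed.

End Presentations.

(** * The two presentations of [H_{n-1}(K)] *)
Section UCT.
Variables (k : fieldType) (d : Order.disp_t) (P : porderType d).
Implicit Types (H A : pmod k P).

Program Definition res_pres H (Q : proj_resolution H) : presentation H :=
  @Presentation _ _ _ _ (Q 0) (Q 1) (@res_proj _ _ _ _ Q 0) (@res_proj _ _ _ _ Q 1)
    (dif Q 1 0) (res_aug Q) (@res_aug_surj _ _ _ _ Q) _.
Next Obligation.
have := res_exact0 x; rewrite mem_kerE => E.
split=> [/eqP|/mem_imP]; first by rewrite E => /mem_imP.
by rewrite -E => /eqP.
Qed.

Definition res_pres_mor H H' (Q : proj_resolution H) (Q' : proj_resolution H')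
    (h : pmor H H') (F : cmor Q Q') (lift : is_lift h F) :
    pres_mor (res_pres Q) (res_pres Q') h :=
  @PresMor _ _ _ _ _ (res_pres Q) (res_pres Q') h (F 0) (F 1)
    (fun p x => congr1 (fun f : pmor _ _ => f p x) lift)
    (fun p y => esym (cfun_difE F 0 y)).

Section Cycles.
Variables (K : uct_complex k P) (n : int).

Definition cycles : pmod k P := psub (pker (dif K n (n - 1))).

Lemma boundaries_proj : projective (psub (pim (dif K n (n - 1)))).
Proof. by have := @uct_boundaries _ _ _ K (n - 1); rewrite /boundaries subrK. Qed.

Lemma cycles_retractK : exists r : pmor (K n) cycles, forall p z, r p (val z) = z.
Proof. exact: cycles_retract boundaries_proj. Qed.

Lemma cycles_proj : projective cycles.
Proof.
have [r rE] := cycles_retractK.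
exact: (@projective_retract _ _ _ _ _ (psub_incl _) r rE (@uct_terms _ _ _ K n)).
Qed.

Definition cycle_class : pmor cycles (chain_homology n K) := hclass _ _.

End Cycles.

Section ComplexPresentation.
Variables (K : uct_complex k P) (n : int).

Lemma dif_cycle p x : dif K n (n - 1) p x \in pker (dif K (n - 1) (n - 1 - 1)) p.
Proof. by rewrite mem_kerE dif_difE. Qed.

Program Definition cplx_pres : presentation (chain_homology (n - 1) K) :=
  @Presentation _ _ _ _ (cycles K (n - 1)) (K n) (@cycles_proj K (n - 1))
    (@uct_terms _ _ _ K n) (corestrict dif_cycle) (cycle_class K (n - 1))
    (@hclass_surj _ _ _ _ _ _ _ _) _.
Next Obligation.
rewrite hclass_eq0 subrK; split=> [[y yx]|[y <-]]; last by exists y.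
by exists y; apply: val_inj.
Qed.

End ComplexPresentation.

Section CyclesMap.
Variables (K K' : uct_complex k P) (n : int) (f : cmor K K').

Program Definition cycles_map : pmor (cycles K n) (cycles K' n) :=
  @corestrict _ _ _ _ _ _ (pmor_comp (f n) (psub_incl _)) _.
Next Obligation.
rewrite mem_kerE /= -cfun_difE; have /eqP-> := valP x; exact/eqP/pfun0.
Qed.

Lemma chain_homology_map_class p z :
  chain_homology_map n f p (cycle_class K n p z) = cycle_class K' n p (cycles_map p z).
Proof.
apply: etrans (homology_map_class (cfun_difE f n) (cfun_difE f (n - 1)) z) _.
by congr (hclass _ _ _ _); apply: val_inj.
Qed.

End CyclesMap.

Program Definition cplx_pres_mor (K K' : uct_complex k P) n (f : cmor K K') :
    pres_mor (cplx_pres K n) (cplx_pres K' n) (chain_homology_map (n - 1) f) :=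
  @PresMor _ _ _ _ _ (cplx_pres K n) (cplx_pres K' n) _ (cycles_map _ f) (f n) _ _.
Next Obligation. exact/esym/(chain_homology_map_class f x). Qed.
Next Obligation. by apply: val_inj; rewrite /= cfun_difE. Qed.

Variable phi : {omorphism P *p P -> P}.

(** Exactness of [Q] in degree 1 identifies the image of [Q_2] with the kernel
of [Q_1 -> Q_0]. *)
Lemma Ext_cocycleP H (Q : proj_resolution H) A p (y : phihom phi (Q 1) A p) :
  y \in pker (dif (phihom_cochain phi Q A) 1 (1 + 1)) p <->
  kills_ker (rel_map (res_pres Q)) y.
Proof.
rewrite mem_kerE; split=> [/eqP y0 s t m /eqP|ker_y].
  rewrite [_ == 0](res_exact (ltr01 : 0 < 1)) => /mem_imP[z <-].
  rewrite -[LHS]/(ev (precomp phi A (dif Q (1 + 1) 1) p y) s t z).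
  by rewrite [precomp _ _ _ _ _]y0.
apply/eqP/phihom_ext => s t m; rewrite ev_precomp ev0.
apply: ker_y; exact: dif_difE.
Qed.

(** Only one implication holds, the kernel of [rel_map (cplx_pres K n)] being
all of [Z_n]; the cocycles missed are those detected by [H_n]. *)
Lemma cocycle_kills (K : uct_complex k P) (n : int) A p (y : phihom phi (K n) A p) :
  kills_ker (rel_map (cplx_pres K n)) y ->
  y \in pker (dif (phihom_cochain phi K A) n (n + 1)) p.
Proof.
move=> ker_y; rewrite mem_kerE; apply/eqP/phihom_ext => s t m; rewrite ev_precomp ev0.
apply: ker_y; apply: val_inj; exact: dif_difE.
Qed.

End UCT.

(** * The short exact sequence *)
Section Sequence.
Variables (k : fieldType) (d : Order.disp_t) (P : porderType d).
Variables (phi : {omorphism P *p P -> P}) (n : int).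
Implicit Types (K : uct_complex k P) (A : pmod k P).

Definition cocycles (C : complex k P up) i : pmod k P := psub (pker (dif C i (i + 1))).

Definition cocycle_class (C : complex k P up) i : pmor (cocycles C i) (cohomology i C) :=
  hclass _ _.

Lemma cocycle_class_surj C i : surjective_pmor (cocycle_class C i).
Proof. exact: hclass_surj. Qed.

Lemma cohomology_map_class (C D : complex k P up) (f : cmor C D) i p
    (y : cocycles C i p) (z : cocycles D i p) :
  val z = f i p (val y) ->
  cohomology_map i f p (cocycle_class C i p y) = cocycle_class D i p z.
Proof.
move=> zE.
apply: etrans (homology_map_class (cfun_difE f i) (cfun_difE f (i + 1)) y) _.
by congr (hclass _ _ _ _); apply: val_inj; rewrite zE.
Qed.

(** The right-hand map restricts cocycles to cycles.  The identity is stated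
after pulling back along [Z_n -> H_n], which is injective on internal homs and
so determines [pi]. *)
Definition is_uct_right K A
    (pi : pmor (cohomology n (phihom_cochain phi K A))
               (phihom phi (chain_homology n K) A)) :=
  forall p (y : cocycles (phihom_cochain phi K A) n p),
    precomp phi A (cycle_class K n) p (pi p (cocycle_class _ n p y)) =
    precomp phi A (psub_incl _) p (val y).

(** The left-hand map is induced by some comparison [c] of presentations.  The
choice of [c] is left open, and [precomp_homotopic] shows that it does not
matter. *)
Definition is_uct_left K A (Q : proj_resolution (chain_homology (n - 1) K))
    (iota : pmor (Ext phi 1 Q A) (cohomology n (phihom_cochain phi K A))) :=
  exists c : pres_mor (cplx_pres K n) (res_pres Q) (pmor_id _),
  forall p (y : cocycles (phihom_cochain phi Q A) 1 p)
           (z : cocycles (phihom_cochain phi K A) n p),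
    val z = precomp phi A (on_rels c) p (val y) ->
    iota p (cocycle_class _ 1 p y) = cocycle_class _ n p z.

Lemma precomp_cycle_class_inj K A : injective_pmor (precomp phi A (cycle_class K n)).
Proof. exact: precomp_inj (@hclass_surj _ _ _ _ _ _ _ _). Qed.

(** A cocycle restricted to [Z_n] kills the boundaries, so it descends to
[H_n]; a coboundary factors through [K_n -> K_{n-1}] and vanishes on [Z_n]. *)
Lemma uct_right_ex K A : exists pi, @is_uct_right K A pi.
Proof.
pose Z := cocycles (phihom_cochain phi K A) n.
pose r : pmor Z (phihom phi (cycles K n) A) :=
  pmor_comp (precomp phi A (psub_incl _)) (psub_incl _).
have [p y|pi0 pi0E] := factor_mono (f := r) (@precomp_cycle_class_inj K A).
  apply: precomp_factor; first exact: hclass_surj.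
  move=> s t z /hclass_eq0[u uz]; rewrite ev_precomp /= -uz.
  have /eqP y0 := valP y.
  have := ev_precomp (A := A) (dif K (n + 1) n) (val y) s t u.
  by move=> <-; rewrite [precomp _ _ _ _ _]y0.
have [p y /hclass_eq0[u uy]|pi piE] :=
  factor_epi (e := cocycle_class (phihom_cochain phi K A) n) (f := pi0)
    (@hclass_surj _ _ _ _ _ _ _ _).
  apply: (@precomp_cycle_class_inj K A); rewrite pi0E pfun0 /= -uy.
  apply: phihom_ext => s t z; rewrite ev_precomp ev0.
  have /eqP z0 := valP z.
  apply: etrans (ev_precomp (dif K n (n - 1)) u s t (val z)) _.
  by rewrite [X in ev _ _ _ X]z0 linear0.
by exists pi => p y; rewrite piE pi0E.
Qed.

Lemma uct_right_section K A pi : @is_uct_right K A pi -> exists s, is_section pi s.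
Proof.
move=> piE; have [r rE] := cycles_retractK K n.
pose h := precomp phi A (pmor_comp (cycle_class K n) r).
have d_cycle p m : dif K (n + 1) n p m \in pker (dif K n (n - 1)) p.
  by rewrite mem_kerE dif_difE.
have h_cocycle p x : h p x \in pker (dif (phihom_cochain phi K A) n (n + 1)) p.
  rewrite mem_kerE; apply/eqP/phihom_ext => s t m; rewrite !ev_precomp ev0 /=.
  rewrite -[dif _ _ _ _ m]/(val (corestrict d_cycle _ m)).
  rewrite rE -[RHS](linear0 (ev x s t)); congr ev.
  by apply/hclass_eq0; exists m.
exists (pmor_comp (cocycle_class (phihom_cochain phi K A) n) (corestrict h_cocycle)).
apply: pmor_ext => p x /=; apply: (@precomp_cycle_class_inj K A); rewrite piE.
by apply: phihom_ext => s t z; rewrite !ev_precomp /= rE.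
Qed.

(** Maps defined on [Z_{n-1}] extend to [K_{n-1}] along the retraction, so the
coboundaries of the complex contain those of the presentation. *)
Lemma cycles_coboundary K A p (u : phihom phi (cycles K (n - 1)) A p) :
  exists w : phihom phi (K (n - 1)) A p,
    precomp phi A (dif K n (n - 1)) p w = precomp phi A (rel_map (cplx_pres K n)) p u.
Proof.
have [r rE] := cycles_retractK K (n - 1); exists (precomp phi A r p u).
apply: phihom_ext => s t m; rewrite !ev_precomp; congr ev.
exact: (rE _ (rel_map (cplx_pres K n) _ m)).
Qed.

Lemma uct_left_ex K A Q : exists iota, @is_uct_left K A Q iota.
Proof.
have [c] := pres_mor_ex (cplx_pres K n) (res_pres Q) (pmor_id _).
pose Z := cocycles (phihom_cochain phi Q A) 1.
pose v : pmor Z (phihom phi (K n) A) :=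
  pmor_comp (precomp phi A (on_rels c)) (psub_incl _).
have v_cocycle p y : v p y \in pker (dif (phihom_cochain phi K A) n (n + 1)) p.
  by apply/cocycle_kills/pres_mor_kills/Ext_cocycleP/(valP y).
have [p y /hclass_eq0[u uy]|iota iotaE] :=
  factor_epi (e := cocycle_class (phihom_cochain phi Q A) 1)
    (f := pmor_comp (cocycle_class (phihom_cochain phi K A) n) (corestrict v_cocycle))
    (@hclass_surj _ _ _ _ _ _ _ _).
  apply/hclass_eq0.
  have [w wE] := cycles_coboundary (precomp phi A (on_gens c) p u).
  exists w; apply: etrans wE _; rewrite /= -uy.
  apply: phihom_ext => s t m; rewrite !ev_precomp -(on_relsE c).
  exact: esym (ev_precomp (dif Q 1 0) u s t (on_rels c _ m)).
exists iota, c => p y z zE; rewrite iotaE.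
apply: (congr1 (cocycle_class (phihom_cochain phi K A) n p)).
by apply: val_inj; rewrite zE.
Qed.

(** Let [b] be a comparison in the direction opposite to [c].  If [y c] is the
coboundary of [w], then [y c b] is the coboundary of [w b], and it differs from
[y] by a coboundary since [c b] is homotopic to the identity. *)
Lemma uct_left_inj K A Q iota : @is_uct_left K A Q iota -> injective_pmor iota.
Proof.
case=> c iotaE p x x' xx'; apply/eqP; rewrite -subr_eq0; apply/eqP.
have {xx'}: iota p (x - x') = 0 by rewrite pfunB xx' subrr.
have [y <-] := cocycle_class_surj (x - x').
have /Ext_cocycleP ker_y := valP y.
have [z zE] := psub_elt (cocycle_kills (pres_mor_kills c (pmor_id A) ker_y)).
rewrite (iotaE p y z zE) => /hclass_eq0[w wE].
have [b] := pres_mor_ex (res_pres Q) (cplx_pres K n) (pmor_id _).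
have [//|u uE] := precomp_homotopic (pres_comp c b) (pres_id (res_pres Q))
  (pmor_id A) _ ker_y.
apply/hclass_eq0.
exists (precomp phi A (pmor_comp (psub_incl _) (on_gens b)) p w - u).
rewrite pfunB.
have -> : dif (phihom_cochain phi Q A) (1 - 1) 1 p u =
    phihom_map phi (on_rels (pres_comp c b)) (pmor_id A) p (val y) - val y.
  by apply: etrans uE _; congr (_ - _); apply: phihom_ext.
apply/eqP; rewrite subr_eq [eqbRHS]addrC [eqbRHS]subrK; apply/eqP/phihom_ext => s t m.
apply: etrans (ev_precomp (dif Q 1 0) _ s t m) _; rewrite ev_precomp ev_map /=.
rewrite -[ev _ _ _ _ in RHS](ev_precomp (on_rels c)) -[precomp _ _ _ _ _]zE -wE.
rewrite [RHS](ev_precomp (dif K n (n - 1))); congr ev.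
exact: (congr1 val (esym (on_relsE b m))).
Qed.

(** A cocycle [y] with zero image in [F H_n] vanishes on [Z_n], so its
composite with a comparison [b] in the direction opposite to [c] is a cocycle
on [Q_1].  The left-hand map sends that to the class of [y b c], which is the
class of [y] as [b c] is homotopic to the identity. *)
Lemma uct_exact K A Q iota pi p x :
    @is_uct_left K A Q iota -> is_uct_right pi ->
  (x \in pim iota p) = (x \in pker pi p).
Proof.
case=> c iotaE piE; rewrite mem_kerE; apply/mem_imP/eqP => [[x' <-]|].
  have [y <-] := cocycle_class_surj x'.
  have /Ext_cocycleP ker_y := valP y.
  have [z zE] := psub_elt (cocycle_kills (pres_mor_kills c (pmor_id A) ker_y)).
  apply: etrans (congr1 (pi p) (iotaE p y z zE)) _.
  apply: (@precomp_cycle_class_inj K A p); rewrite [RHS]pfun0.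
  apply: etrans (piE p z) _; apply: phihom_ext => s t m; rewrite ev_precomp ev0 zE ev_map.
  apply: ker_y; apply: etrans (on_relsE c _) _.
  have -> : rel_map (cplx_pres K n) _ (psub_incl _ _ m) = 0.
    by apply: val_inj; apply/eqP/(valP m).
  exact: pfun0.
have [y <-] := cocycle_class_surj x => pi0.
have ker_y : kills_ker (rel_map (cplx_pres K n)) (val y).
  move=> s t m m0; have m_cycle : m \in pker (dif K n (n - 1)) _.
    by rewrite mem_kerE; apply/eqP/(congr1 val m0).
  have [z <-] := psub_elt m_cycle; rewrite -[LHS](ev_precomp (psub_incl _)).
  by rewrite -[precomp _ _ _ _ _]piE [pi p _]pi0 pfun0.
have [b] := pres_mor_ex (res_pres Q) (cplx_pres K n) (pmor_id _).
have y'_kills := pres_mor_kills b (pmor_id A) ker_y.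
have [y' y'E] : exists y' : cocycles (phihom_cochain phi Q A) 1 p,
    val y' = precomp phi A (on_rels b) p (val y).
  by apply: psub_elt; apply/Ext_cocycleP.
have [z zE] := psub_elt (cocycle_kills (pres_mor_kills c (pmor_id A) y'_kills)).
exists (cocycle_class _ 1 p y').
apply: etrans (iotaE p y' z _) _; first by rewrite zE y'E.
have [//|u uE] := precomp_homotopic (pres_comp b c) (pres_id (cplx_pres K n))
  (pmor_id A) _ ker_y.
have [w wE] := cycles_coboundary u.
apply/hclassP; exists w; apply: etrans wE _; rewrite uE zE.
by congr (_ - _); apply: phihom_ext.
Qed.

Lemma uct_right_natural K K' (f : cmor K K') A A' (g : pmor A A') pi pi' :
    @is_uct_right K A' pi -> @is_uct_right K' A pi' ->
  pmor_comp (phihom_map phi (chain_homology_map n f) g) pi' =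
  pmor_comp pi (cohomology_map n (phihom_cochain_map phi f g)).
Proof.
move=> piE pi'E; apply: pmor_ext => p x; have [y <-] := cocycle_class_surj x.
have [z zE] : exists z : cocycles (phihom_cochain phi K A') n p,
    val z = phihom_cochain_map phi f g n p (val y).
  apply: psub_elt; rewrite mem_kerE -cfun_difE.
  by have /eqP-> := valP y; rewrite pfun0.
apply: (@precomp_cycle_class_inj K A' p).
apply: etrans (esym (congr1 (fun u => precomp phi A' (cycle_class K n) p (pi p u))
  (cohomology_map_class zE))); rewrite piE.
apply: phihom_ext => s t m; rewrite !ev_precomp ev_map chain_homology_map_class zE.
rewrite -[ev (pi' _ _) _ _ _]ev_precomp pi'E !ev_precomp.
exact: esym (ev_map (f n) g (val y) s t _).
Qed.

(** Both composites are induced by a morphism from the presentation by [K] to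
the one by [Q'] lifting [H_{n-1}(f)], namely [f] followed by [c'] and [c]
followed by [F]. *)
Lemma uct_left_natural K K' (f : cmor K K') A A' (g : pmor A A')
    (Q : proj_resolution (chain_homology (n - 1) K))
    (Q' : proj_resolution (chain_homology (n - 1) K')) (F : cmor Q Q') iota iota' :
    is_lift (chain_homology_map (n - 1) f) F ->
    @is_uct_left K A' Q iota -> @is_uct_left K' A Q' iota' ->
  pmor_comp (cohomology_map n (phihom_cochain_map phi f g)) iota' =
  pmor_comp iota (Ext_map phi 1 F g).
Proof.
move=> lift [c cE] [c' c'E]; apply: pmor_ext => p x; have [y <-] := cocycle_class_surj x.
have /Ext_cocycleP ker_y := valP y.
have [z' z'E] := psub_elt (cocycle_kills (pres_mor_kills c' (pmor_id A) ker_y)).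
have [z zE] : exists z : cocycles (phihom_cochain phi K A') n p,
    val z = phihom_cochain_map phi f g n p (val z').
  apply: psub_elt; rewrite mem_kerE -cfun_difE.
  by have /eqP-> := valP z'; rewrite pfun0.
pose Fm := res_pres_mor lift.
have [y' y'E] : exists y' : cocycles (phihom_cochain phi Q A') 1 p,
    val y' = phihom_map phi (on_rels Fm) g p (val y).
  by apply: psub_elt; apply/Ext_cocycleP/pres_mor_kills.
have /Ext_cocycleP ker_y' := valP y'.
have [z'' z''E] := psub_elt (cocycle_kills (pres_mor_kills c (pmor_id A') ker_y')).
apply: etrans (congr1 (cohomology_map n (phihom_cochain_map phi f g) p)
  (c'E p y z' z'E)) _.
apply: etrans (cohomology_map_class zE) _; apply/esym.
apply: etrans (congr1 (iota p)
  (cohomology_map_class (f := phihom_cochain_map phi F g) y'E)) _.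
apply: etrans (cE p y' z'' z''E) _; apply/esym.
have [//|u uE] := precomp_homotopic (pres_comp c' (cplx_pres_mor n f)) (pres_comp Fm c)
  g _ ker_y.
have [w wE] := cycles_coboundary u.
apply/hclassP; exists w; apply: etrans wE (etrans uE _); rewrite zE z''E z'E y'E.
by congr (_ - _); apply: phihom_ext.
Qed.

End Sequence.

Lemma universal_coefficients (k : fieldType) (d : Order.disp_t) (P : porderType d)
    (phi : {omorphism P *p P -> P}) (n : nat) :
  exists (iota : uct_left k phi n) (pi : uct_right k phi n),
    natural_ses iota pi /\
    forall (K : uct_complex k P) (A : pmod k P), exists s, is_section (pi K A) s.
Proof.
pose iota : uct_left k phi n := fun K A Q => projT1 (cid (uct_left_ex phi A Q)).
pose pi : uct_right k phi n := fun K A => projT1 (cid (uct_right_ex phi n K A)).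
have iotaE K A Q : is_uct_left (iota K A Q) by rewrite /iota; case: cid.
have piE K A : is_uct_right (pi K A) by rewrite /pi; case: cid.
exists iota, pi; split; last by move=> K A; apply: uct_right_section.
split=> [K A Q|K K' f A A' g Q Q' F lift|K K' f A A' g].
- split; [exact: uct_left_inj | by move=> p x; apply: uct_exact|].
  have [s sE] := uct_right_section (piE K A).
  by move=> p h; exists (s p h); apply: (congr1 (fun e : pmor _ _ => e p h) sE).
- exact: uct_left_natural.
- exact: uct_right_natural.
Qed.

(** * Zero modules and free modules on one generator *)
Section ZeroModules.
Variables (k : fieldType) (d : Order.disp_t) (P : porderType d).
Implicit Types (M N : pmod k P).

Definition is_zero (M : pmod k P) := forall p (x : M p), x = 0.

Lemma zero_projective M : is_zero M -> projective M.
Proof.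
move=> M0 X Y e f _; exists 0; apply: pmor_ext => p x.
by rewrite (M0 _ x) !pfun0.
Qed.

Lemma zero_exact L M N (f : pmor L M) (g : pmor M N) p x :
  is_zero M -> (x \in pker g p) = (x \in pim f p).
Proof. by move=> M0; rewrite (M0 _ x) !rpred0. Qed.

Lemma zero_homology (L M N : pmod k P) (f : pmor L M) (g : pmor M N) :
  is_zero (psub (pker g)) -> is_zero (homology f g).
Proof. by move=> Z0 p x; have [z <-] := hclass_surj x; rewrite (Z0 _ z) pfun0. Qed.

Lemma zero_phihom phi (M A : pmod k P) : is_zero M -> is_zero (phihom phi M A).
Proof. by move=> M0 p x; apply: phihom_ext => s t m; rewrite (M0 _ m) !linear0. Qed.

Lemma zero_psub M (S : submod M) :
  (forall p x, x \in S p -> x = 0) -> is_zero (psub S).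
Proof. by move=> S0 p x; apply: val_inj; apply: S0 (valP x). Qed.

Lemma image_projective M N (f : pmor M N) :
  injective_pmor f -> projective M -> projective (psub (pim f)).
Proof.
move=> f_inj; have [p y|g gE] := factor_mono (f := psub_incl (pim f)) f_inj.
  exact/mem_imP/(valP y).
apply: (@projective_retract _ _ _ _ _ g (corestrict (im_mem_fun f))) => p y.
by apply: val_inj; rewrite /= gE.
Qed.

End ZeroModules.

Section FreeModules.
Variables (k : fieldType) (d : Order.disp_t) (P : porderType d).

Program Definition const_pmod : pmod k P :=
  @PMod k d P (fun _ => k^o : lmodType k) (fun _ _ _ x => x) _ _ _.
Next Obligation. by move=> a x y. Qed.

Definition generated (o : option P) (p : P) : bool :=
  if o is Some q then (q <= p)%O else false.

Definition free_mem o p : {pred const_pmod p} := [pred x | generated o p || (x == 0)].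

Lemma free_mem_closed o p : submod_closed (@free_mem o p).
Proof.
rewrite /free_mem; split=> [|a x y]; rewrite !inE ?eqxx ?orbT //.
by case: (generated o p) => //= /eqP-> /eqP->; rewrite scaler0 addr0.
Qed.

HB.instance Definition _ o p :=
  GRing.isSubmodClosed.Build k (const_pmod p) (@free_mem o p) (@free_mem_closed o p).

Program Definition free_sub o : submod const_pmod :=
  @Submod _ _ _ _ (fun p => @free_mem o p) _.
Next Obligation.
move: H; rewrite !inE; case: o => //= r; case/orP=> [rp|->]; last by rewrite orbT.
by rewrite (le_trans rp h).
Qed.

(** Realizing these modules inside one constant module avoids objects defined by
cases, and lets their morphisms be given by scalars.  The index [None] stands
for the zero module. *)
Definition free_pmod o : pmod k P := psub (free_sub o).

Lemma free_eq0 o p (x : free_pmod o p) : ~~ generated o p -> x = 0.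
Proof.
move=> Np; apply: val_inj; apply/eqP.
by have := valP x; rewrite inE (negbTE Np).
Qed.

Lemma free_none : is_zero (free_pmod None).
Proof. by move=> p x; apply: free_eq0. Qed.

Lemma free_elt o p (a : k) : generated o p -> exists x : free_pmod o p, val x = a.
Proof. by move=> Up; apply: psub_elt; rewrite inE Up. Qed.

(** A morphism out of [free_pmod (Some q)] is determined by the image of the
generator [1] in degree [q], and any lift [x] of that image defines a lift of
the morphism. *)
Lemma free_projective o : projective (free_pmod o).
Proof.
case: o => [q|]; last exact/zero_projective/free_none.
move=> X Y e f e_surj.
have [u u1] : exists u : free_pmod (Some q) q, val u = 1 by apply/free_elt/lexx.
have [x xE] := e_surj q (f q u).
(* Outside the up-set of [q] any default value will do: it is only multiplied
   by elements of a zero module. *)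
pose xs p : X p := if pselect (q <= p)%O is left h then pstr X h x else 0.
have xsE p (h : (q <= p)%O) : xs p = pstr X h x.
  by rewrite /xs; case: pselect => // h'; rewrite (pstr_irr X h h').
have lin p : linear (fun a : free_pmod (Some q) p => (val a : k) *: xs p).
  by move=> a y z; rewrite scalerA -scalerDl.
have nat p p' (h : (p <= p')%O) (a : free_pmod (Some q) p) :
    (val (pstr (free_pmod (Some q)) h a) : k) *: xs p' = pstr X h ((val a : k) *: xs p).
  rewrite linearZ /=; have [qp|Nqp] := boolP (q <= p)%O.
    by rewrite !xsE ?(le_trans qp h) // => qp'; rewrite (pstr_comp _ _ qp').
  by rewrite (@free_eq0 (Some q) p a) // !scale0r.
exists (PMor lin nat); apply: pmor_ext => p a /=; rewrite linearZ /=.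
have [qp|Nqp] := boolP (q <= p)%O; last first.
  by rewrite (@free_eq0 (Some q) p a) // scale0r pfun0.
rewrite xsE pfun_nat xE -pfun_nat -linearZ; congr (f p _).
by apply: val_inj; rewrite /= u1 [LHS]mulr1.
Qed.

Section Scale.
Variables (o o' : option P) (c : bool).
Hypothesis coo' : forall p, c -> generated o p -> generated o' p.

Lemma scale_subproof p (x : free_pmod o p) : c%:R *: val x \in free_sub o' p.
Proof.
case: c coo' => [oo'|_]; last by rewrite scale0r rpred0.
rewrite scale1r; have := valP x; rewrite !inE.
by case/orP=> [/oo'->|->] //; rewrite orbT.
Qed.

(** A boolean scalar covers the inclusion and the zero map at once, so that
composites are computed on coefficients. *)
Program Definition free_map : pmor (free_pmod o) (free_pmod o') :=
  @corestrict _ _ _ (free_pmod o) _ (free_sub o')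
    (pmorZ c%:R (psub_incl (free_sub o))) _.
Next Obligation. exact: scale_subproof. Qed.

End Scale.

End FreeModules.

(** * A splitting that cannot be natural *)
Section ZeroResolution.
Variables (k : fieldType) (d : Order.disp_t) (P : porderType d).

Program Definition zero_complex : complex k P down :=
  @Complex _ _ _ down (fun _ => free_pmod k None) (fun _ _ => 0) _ _.
Next Obligation. exact: pmor_ext. Qed.

Lemma zero_aug_surj (M : pmod k P) :
  is_zero M -> surjective_pmor (0 : pmor (zero_complex 0) M).
Proof.
move=> M0 p y; exists (0 : (free_pmod k None p : lmodType k)).
by rewrite (M0 _ y).
Qed.

Definition zero_resolution (M : pmod k P) (M0 : is_zero M) : proj_resolution M :=
  @ProjResolution _ _ _ M zero_complex (fun _ p x _ => @free_none k d P p x)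
    (fun _ => @free_projective k d P None) 0 (zero_aug_surj M0)
    (fun _ x => zero_exact _ _ x (@free_none k d P))
    (fun _ _ _ x => zero_exact _ _ x (@free_none k d P)).

Lemma zero_Ext phi (M A : pmod k P) (M0 : is_zero M) :
  is_zero (Ext phi 1 (zero_resolution M0) A).
Proof.
apply: zero_homology => p x; apply: val_inj.
by apply: zero_phihom => q y; apply: free_none.
Qed.

End ZeroResolution.

(** The kernel of [pi] is the image of [Ext^1] computed from any resolution,
in particular from the zero one. *)
Lemma uct_right_inj (k : fieldType) (d : Order.disp_t) (P : porderType d)
    (phi : {omorphism P *p P -> P}) (n : nat) (iota : uct_left k phi n)
    (pi : uct_right k phi n) (K : uct_complex k P) A :
  natural_ses iota pi -> is_zero (chain_homology (n%:Z - 1) K) ->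
  injective_pmor (pi K A).
Proof.
case=> ses _ _ H0 p x x' xx'; apply/eqP; rewrite -subr_eq0; apply/eqP.
have [_ exact_pi _] := ses K A (zero_resolution H0).
have : x - x' \in pker (pi K A) p by rewrite mem_kerE pfunB xx' subrr.
by rewrite -exact_pi => /mem_imP[e <-]; rewrite (zero_Ext e) pfun0.
Qed.

Section Counterexample.
Variable k : fieldType.

(** [ex_uct true] is the inclusion [k_true -> k_false] in degrees 1 and 0, and
[ex_uct false] is [k_true] in degree 1 alone. *)
Definition ex_index (b : bool) (i : int) : option bool :=
  if i == 1 then Some true else if b && (i == 0) then Some false else None.

Definition ex_dif_coef (b : bool) (i j : int) : bool := [&& b, i == 1 & j == 0].

Lemma ex_dif_sub b i j p : ex_dif_coef b i j -> generated (ex_index b i) p ->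
  generated (ex_index b j) p.
Proof. by case/and3P=> -> /eqP-> /eqP->. Qed.

Definition ex_dif b i j := free_map k (@ex_dif_sub b i j).

Lemma ex_dif_down b i j : ~~ down i j -> ex_dif_coef b i j = false.
Proof. by apply: contraNF => /and3P[_ /eqP-> /eqP->]. Qed.

Lemma ex_dif_dif b h i j : ex_dif_coef b i j && ex_dif_coef b h i = false.
Proof. by apply/negP => /andP[/and3P[_ /eqP-> _] /and3P[]]. Qed.

Program Definition ex_complex b : complex k bool down :=
  @Complex _ _ _ down (fun i => free_pmod k (ex_index b i)) (ex_dif b) _ _.
Next Obligation.
by apply: pmor_ext => p x; apply: val_inj; rewrite /= ex_dif_down // scale0r.
Qed.
Next Obligation.
apply: pmor_ext => p x; apply: val_inj; rewrite /= scalerA -natrM mulnb.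
by rewrite ex_dif_dif scale0r.
Qed.

Lemma ex_difE b i j p x :
  val (dif (ex_complex b) i j p x) = (ex_dif_coef b i j)%:R *: val x.
Proof. by []. Qed.

Lemma ex_dif_inj p : injective (dif (ex_complex true) 1 0 p).
Proof.
move=> x y /(congr1 val); rewrite !ex_difE /ex_dif_coef !eqxx !scale1r.
exact: val_inj.
Qed.

Lemma ex_boundaries b i : projective (boundaries (ex_complex b) i).
Proof.
have [/and3P[bT _ /eqP i0]|c0] := boolP (ex_dif_coef b (i + 1) i).
  rewrite {}bT {}i0; apply: image_projective; last exact: free_projective.
  exact: ex_dif_inj.
apply: zero_projective; apply: zero_psub => p x /mem_imP[y <-].
by apply: val_inj; rewrite ex_difE (negbTE c0) scale0r.
Qed.

Definition ex_uct (b : bool) : uct_complex k bool :=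
  @UctComplex k _ _ (ex_complex b) (fun i => @free_projective _ _ _ (ex_index b i))
    (@ex_boundaries b).

Lemma ex_map_sub i p : i == 1 -> generated (ex_index true i) p ->
  generated (ex_index false i) p.
Proof. by move=> /eqP->. Qed.

Program Definition ex_map : cmor (ex_uct true) (ex_uct false) :=
  @CMor _ _ _ _ _ _ (fun i => free_map k (@ex_map_sub i)) _.
Next Obligation.
apply: pmor_ext => p x; apply: val_inj; rewrite /= !scalerA -!natrM !mulnb.
rewrite (_ : [&& _, _ & _] = false) ?mul0n //.
by apply/negP => /and3P[/eqP-> _].
Qed.

Definition ex_phi : {omorphism bool *p bool -> bool} := @proj1 _ bool.

Definition ex_coef : pmod k bool := free_pmod k (Some true).

Program Definition ex_id : phihom ex_phi (ex_uct false 1) ex_coef true :=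
  @Limit _ _ _ (restr (above (@proj2 _ bool) true)
      (ihom (pull (@proj1 _ bool) ex_coef) (pull ex_phi ex_coef)))
    (fun s => pmor_id _) _.
Next Obligation. exact: pmor_ext. Qed.

Lemma ex_idE s t m : ev ex_id s t m = m.
Proof. by []. Qed.

Lemma ex_homology_zero : is_zero (chain_homology 1 (ex_uct true)).
Proof.
apply: zero_homology; apply: zero_psub => p x; rewrite mem_kerE => /eqP x0.
by apply: (@ex_dif_inj p); rewrite [RHS]pfun0.
Qed.

Lemma ex_homology_zero' : is_zero (chain_homology (1%:Z - 1) (ex_uct false)).
Proof. by apply: zero_homology; apply: zero_psub => p x _; apply: free_eq0. Qed.

Lemma ex_cocycle b A p y :
  y \in pker (dif (phihom_cochain ex_phi (ex_uct b) A) 1 (1 + 1)) p.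
Proof.
rewrite mem_kerE; apply/eqP/zero_phihom => q x.
by apply: free_eq0; case: (b).
Qed.

(** The identity of [k_true] does not extend to [k_false]: the generator of
[k_false] lives in degree [false], where the coefficient module is zero, so by
naturality an extension vanishes on its image in degree [true]. *)
Lemma ex_not_coboundary (w : phihom ex_phi (ex_uct true 0) ex_coef true) :
  precomp ex_phi ex_coef (dif (ex_uct true) 1 0) true w <>
  precomp ex_phi ex_coef (ex_map 1) true ex_id.
Proof.
move=> E.
(* The first component of the pairs is the one seen by [ex_phi]; the second
   stays at the base point [true]. *)
pose s : subposet (above (@proj2 _ bool) true) :=
  exist (above (@proj2 _ bool) true) (false, true) isT.
pose t : subposet (upset (subposet_incl s)) :=
  exist (upset (subposet_incl s)) (false, true) isT.
pose t' : subposet (upset (subposet_incl s)) :=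
  exist (upset (subposet_incl s)) (true, true) isT.
have [u u1] : exists u : ex_uct true 0 false, val u = 1 by apply: free_elt.
have [v v1] : exists v : ex_uct true 1 true, val v = 1 by apply: free_elt.
have := congr1 (fun y => ev y s t' v) E; rewrite !ev_precomp ex_idE.
have -> : dif (ex_uct true) 1 0 true v = pstr (ex_uct true 0) (isT : (false <= true)%O) u.
  by apply: val_inj; rewrite ex_difE v1 /= u1 scale1r.
rewrite [LHS](ev_nat w (isT : (t <= t')%O)).
rewrite (_ : ev w s t u = 0) ?linear0 => [/(congr1 val)/eqP|]; last exact: free_eq0.
by rewrite /= v1 scale1r eq_sym oner_eq0.
Qed.

Lemma ex_no_natural_splitting (iota : uct_left k ex_phi 1) (pi : uct_right k ex_phi 1) :
    natural_ses iota pi ->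
  ~ exists s : forall K : uct_complex k bool,
      pmor (phihom ex_phi (chain_homology 1 K) ex_coef)
           (cohomology 1 (phihom_cochain ex_phi K ex_coef)),
    (forall K : uct_complex k bool, is_section (pi K ex_coef) (s K)) /\
    splitting_natural s.
Proof.
move=> ses [s [sec nat]].
have [y yE] : exists y : cocycles (phihom_cochain ex_phi (ex_uct false) ex_coef) 1 true,
    val y = ex_id.
  by apply/psub_elt/ex_cocycle.
set C := phihom_cochain _ _ _ in y yE.
have [z zE] : exists z : cocycles (phihom_cochain ex_phi (ex_uct true) ex_coef) 1 true,
    val z = precomp ex_phi ex_coef (ex_map 1) true ex_id.
  by apply/psub_elt/ex_cocycle.
(* As [pi] is injective for [ex_uct false], its section is surjective. *)
have sK : s (ex_uct false) true (pi (ex_uct false) ex_coef true (cocycle_class C 1 true y))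
    = cocycle_class C 1 true y.
  apply: (uct_right_inj ses ex_homology_zero' (p := true)).
  exact: (congr1 (fun e : pmor _ _ => e true _) (sec (ex_uct false))).
pose fC := phihom_cochain_map ex_phi ex_map (pmor_id ex_coef).
have fy : cohomology_map 1 fC true (cocycle_class C 1 true y) = cocycle_class _ 1 true z.
  by apply: (cohomology_map_class (f := fC)); rewrite zE yE.
have fh0 : phihom_map ex_phi (chain_homology_map 1 ex_map) (pmor_id ex_coef) true
    (pi (ex_uct false) ex_coef true (cocycle_class C 1 true y)) = 0.
  exact: (zero_phihom ex_homology_zero).
have z0 : cocycle_class (phihom_cochain ex_phi (ex_uct true) ex_coef) 1 true z = 0.
  apply: etrans (esym fy) (etrans (congr1 (cohomology_map 1 fC true) (esym sK)) _).
  apply: etrans (congr1 (fun e : pmor _ _ => e true _) (nat _ _ ex_map)) _.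
  exact: etrans (congr1 (s (ex_uct true) true) fh0) (pfun0 (s (ex_uct true)) true).
by case/hclass_eq0: z0 => w wE; apply: (@ex_not_coboundary w); rewrite -zE -wE.
Qed.

End Counterexample.

Theorem theorem5p7 (k : fieldType) :
  (forall (d : Order.disp_t) (P : porderType d) (phi : {omorphism P *p P -> P})
     (n : nat),
   exists (iota : uct_left k phi n) (pi : uct_right k phi n),
     natural_ses iota pi /\
     forall (K : uct_complex k P) (A : pmod k P),
       exists s : pmor (phihom phi (chain_homology n K) A)
                       (cohomology n (phihom_cochain phi K A)),
         is_section (pi K A) s) /\
  (exists (d : Order.disp_t) (P : porderType d) (phi : {omorphism P *p P -> P})
     (n : nat) (A : pmod k P),
   forall (iota : uct_left k phi n) (pi : uct_right k phi n),
     natural_ses iota pi ->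
     ~ exists s : forall K : uct_complex k P,
           pmor (phihom phi (chain_homology n K) A)
                (cohomology n (phihom_cochain phi K A)),
         (forall K : uct_complex k P, is_section (pi K A) (s K)) /\
         splitting_natural s).
Proof.
split=> [d P phi n|]; first exact: universal_coefficients.
exists _, bool, ex_phi, 1%N, (ex_coef k) => iota pi.
exact: ex_no_natural_splitting.
Qed.
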